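(* Let $A$ be an irreducible nonnegative matrix indexed by a countable set $S$ and assume that $\rho(A)<\infty$. Let $B\leq A$ (entrywise) be another nonnegative matrix indexed by $S$ such that $B(x,y)>0$ if and only if $A(x,y)>0$ (for all $x,y\in S$), and $B\neq A$. Then: (a) If $A$ is strongly R-positive, then $\rho(B)<\rho(A)$. (b) If $\rho(B)<\rho(A)$ and the set $\{(x,y)\in S^2:A(x,y)\neq B(x,y)\}$ is finite, then $A$ is strongly R-positive.
   Context: A nonnegative matrix $A=(A(x,y))_{x,y\in S}$ (entries in $[0,\infty)$) indexed by a countable (finite or infinite) set $S$ is irreducible if for each $x,y\in S$ there is an $n\geq 1$ such that $A^n(x,y)>0$. For irreducible $A$, the spectral radius is $\rho(A):=\lim_{n\to\infty}(A^n(x,x))^{1/n}\in(0,\infty]$, where, if $A$ is periodic, $n$ ranges only through those integers for which $A^n(x,x)>0$; the limit exists and does not depend on $x\in S$. An irreducible nonnegative matrix $A$ is R-recurrent if $\rho(A)<\infty$ and $\sum_{n=1}^\infty\rho(A)^{-n}A^n(x,x)=\infty$ for some (equivalently all) $x\in S$. If $A$ is R-recurrent, it is known that there exist a function $h:S\to(0,\infty)$, unique up to scalar multiples, and a unique constant $c>0$ such that $P(x,y):=c^{-1}h(x)^{-1}A(x,y)h(y)$ ($x,y\in S$) defines a recurrent probability kernel $P$ on $S$; moreover $c=\rho(A)$. An irreducible probability kernel $P$ on $S$ is strongly positive recurrent if for some (equivalently all) $x\in S$ there is an $\varepsilon>0$ such that $\mathbb{E}^x[e^{\varepsilon\sigma_x}]<\infty$,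 where $\sigma_x:=\inf\{k>0:X_k=x\}$ is the first return time to $x$ of the Markov chain $(X_k)_{k\geq 0}$ with transition kernel $P$ started in $X_0=x$ (so in particular $\sigma_x<\infty$ almost surely). The matrix $A$ is strongly R-positive if it is R-recurrent and the unique recurrent probability kernel $P$ of the form $P(x,y)=c^{-1}h(x)^{-1}A(x,y)h(y)$ ($x,y\in S$), with $h:S\to(0,\infty)$ a function and $c>0$ a constant (necessarily $c=\rho(A)$), is strongly positive recurrent. *)

(* Defs.v *)
From HB Require Import structures.
From mathcomp Require Import all_boot all_order all_algebra.
From mathcomp Require Import all_classical all_reals all_analysis.

Set Implicit Arguments.
Unset Strict Implicit.
Unset Printing Implicit Defensive.

Import Order.TTheory GRing.Theory Num.Theory.
Import numFieldNormedType.Exports.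

Local Open Scope classical_set_scope.
Local Open Scope ring_scope.
Local Open Scope ereal_scope.

Section Matrices.
Context {R : realType} {S : countType}.
Implicit Types (A P : S -> S -> R) (x y : S) (n : nat).

Definition nonnegative_matrix A := forall x y, (0 <= A x y)%R.

(* Powers take values in [0, +oo] because the row-by-column sums need not
   converge when S is infinite. *)
Fixpoint matrix_pow A n x y : \bar R :=
  if n is n'.+1 then \esum_(z in [set: S]) ((A x z)%:E * matrix_pow A n' z y)
  else if x == y then 1 else 0.

Definition irreducible A :=
  forall x y, exists2 n, (1 <= n)%N & 0 < matrix_pow A n x y.

(* The common value, over all x, of the limit of (A^n(x,x))^(1/n) as n tends to
   infinity among the n with A^n(x,x) > 0. For an irreducible nonnegative
   matrix on a nonempty S this limit exists and does not depend on x, so the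
   set below is a singleton; otherwise [get] may return an arbitrary value. *)
Definition spectral_radius A : \bar R :=
  get [set r : \bar R | forall x,
    poweR (matrix_pow A n x x) (n%:R^-1)%R
      @[n --> within [set n | 0 < matrix_pow A n x x] \oo] --> r].

Definition R_recurrent A :=
  [/\ irreducible A, spectral_radius A < +oo &
    exists x, \sum_(1 <= n <oo)
      (((fine (spectral_radius A)) ^- n)%:E * matrix_pow A n x x) = +oo].

Definition is_probability_kernel P :=
  nonnegative_matrix P /\
  forall x, \esum_(y in [set: S]) (P x y)%:E = 1.

End Matrices.

Section MarkovChains.
Context {R : realType} {S : countType}.

(* X is a Markov chain with transition kernel P and X_0 = x almost surely; the
   Markov property
     Pr[X_(n+1) = s_(n+1) | X_0 = s_0, ..., X_n = s_n] = P(s_n, s_(n+1))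
   is written in product form, so as to cover null conditioning events. *)
Definition markov_chain (P : S -> S -> R) (x : S) (d : measure_display)
    (T : measurableType d) (Pr : probability T R) (X : nat -> T -> S) :=
  [/\ forall n y, measurable (X n @^-1` [set y]),
      Pr [set w | X 0%N w = x] = 1 &
      forall (n : nat) (s : nat -> S),
        Pr [set w | forall k, (k <= n.+1)%N -> X k w = s k] =
        Pr [set w | forall k, (k <= n)%N -> X k w = s k] *
          (P (s n) (s n.+1))%:E].

Definition first_return (T : Type) (X : nat -> T -> S) (x : S) (w : T) : \bar R :=
  ereal_inf [set (k%:R)%:E | k in [set k | (0 < k)%N /\ X k w = x]].

(* In the next two definitions the chain may live on any probability space: its
   law is determined by P and x, and such a chain always exists when P is a
   probability kernel, so "for some chain" and "for every chain" agree. *)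
Definition recurrent (P : S -> S -> R) :=
  forall x, exists (d : measure_display) (T : measurableType d)
      (Pr : probability T R) (X : nat -> T -> S),
    markov_chain P x Pr X /\ Pr [set w | first_return X x w < +oo] = 1.

Definition strongly_positive_recurrent (P : S -> S -> R) :=
  [/\ is_probability_kernel P, irreducible P &
    exists x, exists2 e : R, (0 < e)%R &
      exists (d : measure_display) (T : measurableType d)
        (Pr : probability T R) (X : nat -> T -> S),
      markov_chain P x Pr X /\
      \int[Pr]_(w in [set: T]) expeR (e%:E * first_return X x w) < +oo].

(* For R-recurrent A the recurrent kernel P of this form is unique. *)
Definition strongly_R_positive (A : S -> S -> R) :=
  R_recurrent A /\
  exists (h : S -> R) (c : R),
    let P := fun x y => (c^-1 * (h x)^-1 * A x y * h y)%R in
    [/\ forall x, (0 < h x)%R, (0 < c)%R, is_probability_kernel P, recurrent P &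
        strongly_positive_recurrent P].

End MarkovChains.

(* Main.v *)
Require Import Defs.
From HB Require Import structures.
From mathcomp Require Import all_boot all_order all_algebra.
From mathcomp Require Import all_classical all_reals all_analysis.
From mathcomp Require Import measurable_realfun ring lra zify.

(** Let [F_x(z)] be the generating function of the weights of the first-return loops of a
    matrix at [x], and [G_x(z)] that of all its loops. Splitting a loop at its returns gives the
    renewal equation [G = 1 + F G], and with it two facts that carry the whole proof
    ([spectral_radius_le_invr] and [passage_gf_le1_invr]): the spectral radius is at most
    [1/z] if and only if [F_x(z) <= 1]. They rest on a root-free description of the spectral
    radius ([spectral_radius_le]), which comes from Fekete's lemma.

    If [F_x(r) = 1], the first-passage generating function from [y] to [x] at [r] is, as a
    function [h] of [y], a positive finite eigenvector. The Doob transform of the matrix by [h]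
    is a probability kernel whose first-return probabilities are the coefficients of
    [F_x] at [r]. Hence strong R-positivity says exactly that, for some [x] and with [r] the
    inverse of the spectral radius, [F_x(r) = 1] and [F_x(q)] is finite for some [q > r]
    ([passage_critical]). The direction that produces a kernel needs an actual Markov chain:
    it is built on the unit interval by subdividing intervals in the proportions of the rows of
    the kernel ([interval_chainP]). The other direction reads [F_x] off the law of the first
    return time ([prob_return], [expectation_return]).

    For (a), the eigenvectors of [A] and [B] at [r] would agree if both first-return functions
    were [1] there, and this forces [B = A] ([passage_gf_rigid]). So that of [B] is below [1] at
    [r], finite at [q], and by convexity at most [1] slightly beyond [r]
    ([passage_gf_beyond]): the spectral radius of [B] is smaller than [1/r].

    For (b), suppose first that [A] and [B] differ in row [x] only. A first-return loop at [x]
    uses that row once, so [F_x] of [A] is at most a constant times [F_x] of [B], which is at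
    most [1] at the inverse radius of [B], to the right of [r]. So [F_x(q)] is finite for some
    [q > r], and [F_x(r) = 1] because a smaller value would lower the spectral radius of [A].
    In general the changed entries are reset one at a time; as soon as a
    jump has occurred, (a) makes every further change increase the radius, so that the last
    change is always a jump ([passage_critical_of_jump]). *)

Set Implicit Arguments.
Unset Strict Implicit.
Unset Printing Implicit Defensive.
Import Order.TTheory GRing.Theory Num.Theory.
Local Open Scope classical_set_scope.
Local Open Scope ring_scope.

(** * Sums of extended nonnegative reals *)

Section NonnegativeSums.
Local Open Scope ereal_scope.
Context {R : realType} {T : choiceType}.
Implicit Types (I : set T) (a b : T -> \bar R).

Lemma esum_ge_term I a i : (forall j, I j -> 0 <= a j) -> I i ->
  a i <= \esum_(j in I) a j.
Proof.
move=> a0 Ii; apply: esum_ge; exists [set i]; last by rewrite fsbig_set1.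
by split=> // j ->.
Qed.

Lemma esum_gt0P I a : 0 < \esum_(j in I) a j -> exists2 i, I i & 0 < a i.
Proof.
move=> s0; apply: contrapT => no; move: s0; apply/negP; rewrite -leNgt.
rewrite -(@esum1 R T I (fun=> 0)) //; apply: le_esum => i Ii.
by rewrite leNgt; apply/negP => ai; apply: no; exists i.
Qed.

Lemma esumZl I a (c : \bar R) : 0 <= c -> (forall i, 0 <= a i) ->
  \esum_(i in I) (c * a i) = c * \esum_(i in I) a i.
Proof.
move=> c0 a0.
have le_real (d : R) b : (0 <= d)%R -> (forall i, 0 <= b i) ->
    \esum_(i in I) (d%:E * b i) <= d%:E * \esum_(i in I) b i.
  move=> d0 b0; apply: ge_ereal_sup => _ [X [finX XI] <-].
  rewrite -ge0_mule_fsumr//.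
  by apply: lee_wpmul2l; rewrite ?lee_fin//; apply: ereal_sup_ubound; exists X.
case: c c0 => [c|_|//]; last first.
  have [s0|/eqP s0] := eqVneq (\esum_(i in I) a i) 0.
    rewrite s0 mule0 esum1// => i Ii; suff -> : a i = 0 by rewrite mule0.
    by apply/eqP; rewrite eq_le a0// andbT -s0 esum_ge_term.
  have {s0}s0 : 0 < \esum_(i in I) a i.
    by rewrite lt_neqAle eq_sym esum_ge0// andbT; apply/eqP.
  rewrite [RHS]gt0_mulye//; have [i Ii ai] := esum_gt0P s0.
  apply/eqP; rewrite -leye_eq.
  have mge0 j : I j -> 0 <= +oo * a j by move=> _; apply: mule_ge0.
  by apply: le_trans (esum_ge_term mge0 Ii); rewrite gt0_mulye.
rewrite le_eqVlt => /orP[/eqP <-|]; first by rewrite mul0e esum1// => i _; rewrite mul0e.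
rewrite lte_fin => c0; apply/eqP; rewrite eq_le le_real ?(ltW c0)//=.
rewrite muleC -lee_pdivlMr// [leRHS]muleC.
have -> : \esum_(i in I) a i = \esum_(i in I) (c^-1%:E * (c%:E * a i)).
  by apply: eq_esum => i _; rewrite muleA -EFinM mulVf ?gt_eqF// mul1e.
apply: le_real; first by rewrite invr_ge0 ltW.
by move=> i; apply: mule_ge0; rewrite // lee_fin ltW.
Qed.

Lemma esumZr I a (c : \bar R) : 0 <= c -> (forall i, 0 <= a i) ->
  \esum_(i in I) (a i * c) = (\esum_(i in I) a i) * c.
Proof.
by move=> c0 a0; rewrite muleC -esumZl//; apply: eq_esum => i _; rewrite muleC.
Qed.

Lemma esumD1 a x : (forall i, 0 <= a i) ->
  \esum_(i in [set: T]) a i = a x + \esum_(i in [set~ x]) a i.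
Proof. by move=> a0; rewrite (esumID [set x])// !setTI esum_set1. Qed.

Lemma esum_swap (T' : choiceType) I (J : set T') (a : T -> T' -> \bar R) :
  (forall i j, 0 <= a i j) ->
  \esum_(i in I) \esum_(j in J) a i j = \esum_(j in J) \esum_(i in I) a i j.
Proof.
move=> a0; rewrite !esum_esum//.
rewrite (reindex_esum (J `*` I) _ (fun x => (x.2, x.1)))//; split=> //=.
- by move=> [i j] [/=].
- by move=> [i1 i2] [j1 j2] /= _ _ [] -> ->.
- by move=> [i1 i2] [Pi1 Qi2] /=; exists (i2, i1).
Qed.

(** Removing the [i]-th term of both sums costs only finite quantities, so a strict gap at
    one index cannot be compensated by the others. *)
Lemma eq_esum_term a b : (forall i, 0 <= a i) -> (forall i, a i <= b i) ->
  \esum_(i in [set: T]) b i <= \esum_(i in [set: T]) a i ->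
  \esum_(i in [set: T]) b i < +oo -> forall i, a i = b i.
Proof.
move=> a0 ab sba sboo i.
have b0 j : 0 <= b j by apply: le_trans (ab j).
move: (sba) (sboo); rewrite (esumD1 i b0) (esumD1 i a0).
have : \esum_(j in [set~ i]) a j <= \esum_(j in [set~ i]) b j.
  by apply: le_esum => j _.
have : 0 <= \esum_(j in [set~ i]) a j by apply: esum_ge0.
have : 0 <= \esum_(j in [set~ i]) b j by apply: esum_ge0.
move: (a0 i) (ab i) (b0 i).
move: (a i) (b i) (esum [set~ i] a) (esum [set~ i] b) => [p| |] [q| |] [r| |] [s| |] //=.
rewrite -!EFinD !lee_fin => *; congr (_%:E).
lra.
Qed.

End NonnegativeSums.

Section NonnegativeSeries.
Local Open Scope ereal_scope.
Context {R : realType}.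
Implicit Types (a : nat -> \bar R) (c : \bar R).

Lemma le_esum_nat a n : (forall k, 0 <= a k) ->
  \sum_(k < n) a k <= \esum_(k in [set: nat]) a k.
Proof.
move=> a0; rewrite -nneseries_esumT// -(big_mkord xpredT a).
by apply: nneseries_lim_ge.
Qed.

Lemma esum_nat_le a c : (forall k, 0 <= a k) ->
  (forall n, \sum_(k < n) a k <= c) -> \esum_(k in [set: nat]) a k <= c.
Proof.
move=> a0 ac; rewrite -nneseries_esumT//; apply: lime_le; first exact: is_cvg_nneseries.
by apply: nearW => n; rewrite big_mkord.
Qed.

Lemma lt_esum_nat a c : (forall k, 0 <= a k) ->
  c < \esum_(k in [set: nat]) a k -> exists n, c < \sum_(k < n) a k.
Proof.
move=> a0 ca; apply: contrapT => no; move: ca; apply/negP; rewrite -leNgt.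
apply: esum_nat_le => // n; rewrite leNgt; apply/negP => can.
by apply: no; exists n.
Qed.

Lemma esum_natS a : (forall k, 0 <= a k) ->
  \esum_(k in [set: nat]) a k = a 0%N + \esum_(k in [set: nat]) a k.+1.
Proof.
move=> a0; rewrite (esumD1 0%N a0); congr (_ + _).
apply: reindex_esum; split; first by [].
  by move=> i j _ _ [].
by move=> [|i]//= _; exists i.
Qed.

Lemma esum_nat_shift a m : (forall k, 0 <= a k) ->
  \esum_(k in [set: nat]) a (m + k)%N <= \esum_(k in [set: nat]) a k.
Proof.
elim: m a => [//|m IH] a a0; rewrite (esum_natS a0).
apply: le_trans (IH (fun k => a k.+1) _) _ => //.
by rewrite leeDr.
Qed.

(** Lets a sum over a countable type be computed along the encoding of its elements. *)
Lemma esum_pickle (T : countType) a :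
  (forall i, ~ (exists z : T, pickle z = i) -> a i = 0) ->
  \esum_(i in [set: nat]) a i = \esum_(z in [set: T]) a (pickle z).
Proof.
move=> a0; rewrite -(esum_image [set: T] pickle a); last first.
  by move=> u v _ _; exact: (pcan_inj pickleK).
rewrite [RHS]esum_mkcond; apply: eq_esum => i _.
case: ifPn => // /negP no; rewrite a0// => -[z zi].
by apply: no; apply/mem_set; exists z.
Qed.

End NonnegativeSeries.

(** * Roots of supermultiplicative sequences *)

Section Growth.
Local Open Scope ereal_scope.
Context {R : realType}.

(** Besides divergence of [q ^+ j], the linear factor is what refutes an at most linear
    growth of the partial sums of the Green function in [passage_gf_le1]. *)
Lemma expr_ge_linear (q C : R) : (1 < q)%R ->
  exists J, forall j, (J <= j)%N -> (C * j%:R <= q ^+ j)%R.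
Proof.
move=> q1; have [d d0 ->] : exists2 d : R, (0 < d)%R & q = (1 + d)%R.
  by exists (q - 1)%R; [rewrite subr_gt0|lra].
have bern j : (1 + j%:R * d <= (1 + d) ^+ j)%R.
  elim: j => [|j IH]; first by rewrite mul0r addr0 expr0.
  rewrite exprS -natr1; have j0 : (0 <= j%:R :> R)%R by [].
  have := ler_wpM2l (_ : (0 <= 1 + d)%R) IH; rewrite addr_ge0 ?(ltW d0)// => /(_ isT).
  nra.
have quad j : (j%:R * (j%:R - 1) / 2 * (d * d) <= (1 + d) ^+ j)%R.
  elim: j => [|j IH]; first by rewrite !mul0r expr0.
  rewrite exprS -natr1 mulrDl mul1r.
  have := ler_wpM2l (ltW d0) (bern j).
  lra.
(* Beyond this index half of [(j - 1) * d ^ 2] already exceeds [C]. *)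
exists (Num.trunc (2 * `|C| / (d * d) + 1)).+1 => j Jj.
have dd0 : (0 < d * d)%R by exact: mulr_gt0.
apply: le_trans (quad j).
have : (2 * `|C| / (d * d) + 1 < j%:R)%R.
  by rewrite -truncn_lt_nat// addr_ge0// divr_ge0 ?mulr_ge0// ltW.
rewrite -ltrBrDr ltr_pdivrMr// => Cj.
have := ler_norm C; have : (0 <= j%:R :> R)%R by [].
nra.
Qed.

End Growth.

Section Roots.
Local Open Scope ereal_scope.
Context {R : realType}.
Implicit Types (t : R) (n : nat) (a : \bar R).

Lemma root_expr t n : (0 <= t)%R -> ((t ^+ n.+1) `^ (n.+1%:R^-1))%R = t.
Proof.
by move=> t0; rewrite -powR_mulrn// -powRrM mulfV ?powRr1.
Qed.

Lemma expr_root t n : (0 <= t)%R -> ((t `^ (n.+1%:R^-1)) ^+ n.+1)%R = t.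
Proof.
by move=> t0; rewrite -powR_mulrn ?powR_ge0// -powRrM mulVf ?powRr1.
Qed.

Lemma le_root t n a : (0 <= t)%R -> 0 <= a ->
  (t%:E <= poweR a (n.+1%:R^-1)%R) = ((t ^+ n.+1)%:E <= a).
Proof.
move=> t0; have p0 : (0 <= n.+1%:R^-1 :> R)%R by rewrite invr_ge0.
case: a => [a|_|//]; last by rewrite poweRyr ?leey// invr_eq0 pnatr_eq0.
rewrite poweR_EFin !lee_fin => a0; apply/idP/idP => h.
  rewrite -(expr_root n a0); apply: lerXn2r h => //; rewrite nnegrE ?powR_ge0//.
by rewrite -(root_expr n t0) ge0_ler_powR ?nnegrE ?exprn_ge0.
Qed.

Lemma root_le t n a : (0 <= t)%R -> 0 <= a ->
  (poweR a (n.+1%:R^-1)%R <= t%:E) = (a <= (t ^+ n.+1)%:E).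
Proof.
move=> t0; have p0 : (0 <= n.+1%:R^-1 :> R)%R by rewrite invr_ge0.
case: a => [a|_|//]; last first.
  by rewrite poweRyr ?invr_eq0 ?pnatr_eq0// !leye_eq.
rewrite poweR_EFin !lee_fin => a0; apply/idP/idP => h.
  by rewrite -(expr_root n a0); apply: lerXn2r h => //; rewrite nnegrE ?powR_ge0.
by rewrite -(root_expr n t0) ge0_ler_powR ?nnegrE ?exprn_ge0.
Qed.

End Roots.

Section Supermultiplicative.
Local Open Scope ereal_scope.
Context {R : realType}.
Variable a : nat -> \bar R.
Hypothesis a_ge0 : forall n, 0 <= a n.
Hypothesis a0 : a 0%N = 1.
Hypothesis aM : forall m n, a m * a n <= a (m + n)%N.

Lemma supermul_pow m j : (a m ^+ j) <= a (j * m)%N.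
Proof.
elim: j => [|j IH]; first by rewrite a0.
by rewrite expeS mulSn; apply: le_trans (aM _ _); apply: lee_wpmul2l.
Qed.

(** The hypothesis on [m] is strict, so [a m / t ^+ m] exceeds some [q > 1], and the powers of
    [q] absorb any constants [c] and [C]. *)
Lemma supermul_growth (t : R) m (c : \bar R) (C : R) : (0 < t)%R -> 0 < c ->
  (t ^+ m)%:E < a m ->
  exists J, forall j, (J <= j)%N -> (C * t ^+ (j * m))%:E <= c * a (j * m)%N.
Proof.
move=> t0 c0 tm.
have [q q1 qm] : exists2 q : R, (1 < q)%R & (q * t ^+ m)%:E <= a m.
  case: (a m) tm (a_ge0 m) => [s| |]//; last by exists 2%R; [lra|exact: leey].
  rewrite lte_fin => ts _; exists (s / t ^+ m)%R.
    by rewrite ltr_pdivlMr ?exprn_gt0// mul1r.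
  by rewrite mulfVK// gt_eqF ?exprn_gt0.
have [b b0 bc] : exists2 b : R, (0 < b)%R & b%:E <= c.
  case: c c0 => [s| |]//; last by exists 1%R; [lra|exact: leey].
  by rewrite lte_fin => s0; exists s.
have [J0 hJ] := expr_ge_linear (`|C| / b) q1.
exists J0.+1 => j Jj.
have j1 : (1 <= j%:R :> R)%R by rewrite ler1n; apply: leq_trans Jj.
have Cq : (C <= b * q ^+ j)%R.
  have := hJ j (ltnW Jj); rewrite mulrAC ler_pdivrMr// [leRHS]mulrC; apply: le_trans.
  by apply: le_trans (ler_norm C) _; rewrite ler_peMr.
apply: (@le_trans _ _ (b%:E * (a m ^+ j))).
  apply: (@le_trans _ _ (b%:E * ((q * t ^+ m)%:E ^+ j))).
    rewrite -EFin_expe -EFinM lee_fin exprMn -exprM mulnC mulrA.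
    by apply: ler_wpM2r => //; rewrite exprn_ge0// ltW.
  apply: lee_wpmul2l; first by rewrite lee_fin ltW.
  elim: {J0 hJ Jj j1 Cq} j => [//|j IH]; rewrite !expeS; apply: lee_pmul => //.
    by rewrite lee_fin mulr_ge0 ?exprn_ge0 ?ltW//; lra.
  by apply: expe_ge0; rewrite lee_fin mulr_ge0 ?exprn_ge0 ?ltW//; lra.
apply: lee_pmul => //; [by rewrite lee_fin ltW|exact: expe_ge0|exact: supermul_pow].
Qed.

Let returns := within [set n | 0 < a n] \oo.
Let root n := poweR (a n) (n%:R^-1)%R.
Definition growth : \bar R := ereal_sup [set root n.+1 | n in [set: nat]].

(** A residue class modulo [m] that contains some [s] with [0 < a s] is served by the products
    [a s * a m ^+ j]; the other classes contain no index with [0 < a n]. There are finitely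
    many classes, so periodicity needs no separate treatment. *)
Lemma root_eventually_ge (t : R) m : (0 < t)%R -> (t ^+ m)%:E < a m ->
  \forall n \near returns, t%:E <= root n.
Proof.
move=> t0 tm.
have m0 : (0 < m)%N.
  by case: m tm => //; rewrite a0 expr0 ltxx.
have residue (r : 'I_m) : \forall n \near \oo, 0 < a n -> n = r %[mod m] ->
    (t ^+ n)%:E <= a n.
  have [[s sr as0]|no] := pselect (exists2 s, s = r %[mod m] & 0 < a s); last first.
    by apply: nearW => n an nr; exfalso; apply: no; exists n.
  have [J hJ] := supermul_growth (t ^+ s)%R t0 as0 tm.
  near=> n => an nr.
  have sn : (s + J * m <= n)%N by near: n; exact: nbhs_infty_ge.
  have [j nE] : exists j, n = (s + j * m)%N.
    have sn' : (s <= n)%N by apply: leq_trans sn; apply: leq_addr.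
    have : (m %| n - s)%N by rewrite -eqn_mod_dvd// nr sr.
    by move=> /dvdnP[j jE]; exists j; rewrite -jE subnKC.
  have Jj : (J <= j)%N by move: sn; rewrite nE leq_add2l leq_pmul2r.
  rewrite nE exprD; apply: le_trans (hJ j Jj) _; exact: aM.
have all_residues : \forall n \near \oo, forall r : 'I_m, 0 < a n -> n = r %[mod m] ->
    (t ^+ n)%:E <= a n by exact: filter_forall.
rewrite /returns near_withinE; near=> n.
have n0 : (0 < n)%N by near: n; exact: nbhs_infty_gt.
have resn : forall r : 'I_m, 0 < a n -> n = r %[mod m] -> (t ^+ n)%:E <= a n.
  by near: n.
move=> an.
have tn : (t ^+ n)%:E <= a n.
  by apply: (resn (Ordinal (ltn_pmod n m0)) an); rewrite /= modn_mod.
by move: tn; rewrite -(prednK n0) /root le_root// ltW.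
Unshelve. all: by end_near. Qed.

Hypothesis a_gt0 : exists n, 0 < a n.+1.

Let growth_gt0 : 0 < growth.
Proof.
have [n an] := a_gt0; apply: (@lt_le_trans _ _ (root n.+1)); first exact: poweR_gt0.
by apply: ereal_sup_ubound; exists n.
Qed.

(** Powers in place of roots: in this form the growth rate combines with generating functions. *)
Lemma growth_leP (t : R) : (0 <= t)%R ->
  growth <= t%:E <-> forall n, a n <= (t ^+ n)%:E.
Proof.
move=> t0; split=> [gt [|n]|h]; first by rewrite a0 expr0.
  rewrite -root_le//; apply: le_trans gt; apply: ereal_sup_ubound; by exists n.
by apply: ge_ereal_sup => _ [n _ <-]; rewrite /root root_le.
Qed.

Lemma returns_proper : ProperFilter returns.
Proof.
split; last exact: within_filter.
rewrite /returns /within/= => -[N _ hN].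
have [n an] := a_gt0.
have := hN (N.+1 * n.+1)%N; apply.
  by rewrite /= (leq_trans (leqnSn N))// leq_pmulr.
by apply: lt_le_trans (supermul_pow _ _); apply: expe_gt0.
Qed.

(** This is Fekete's lemma for the possibly infinite values of a supermultiplicative sequence. *)
Lemma root_cvg : root n @[n --> returns] --> growth.
Proof.
have ev (t : R) : t%:E < growth -> \forall n \near returns, t%:E <= root n.
  move=> tg; have [t0|t0] := leP t 0%R.
    by near=> n; apply: le_trans (poweR_ge0 _ _); rewrite lee_fin.
  have [_ [m _ <-] tm] := ereal_sup_gt tg.
  apply: (@root_eventually_ge t m.+1) => //.
  by move: tm; rewrite !ltNge /root root_le// ltW.
have le_growth : \forall n \near returns, root n <= growth.
  rewrite /returns near_withinE; near=> n => _.
  have n0 : (0 < n)%N by near: n; exact: nbhs_infty_gt.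
  by rewrite -(prednK n0); apply: ereal_sup_ubound; exists n.-1.
case: growth growth_gt0 ev le_growth => [g| |]// g0 ev le_growth; last first.
  by apply/cvgeyPge => t; apply: ev; rewrite ltry.
have fin : \forall n \near returns, root n \is a fin_num.
  near=> n; rewrite ge0_fin_numE ?poweR_ge0//.
  by apply: le_lt_trans (ltry g); near: n.
apply/fine_cvgP; split=> //; apply/cvgrPdist_le => e e0.
have eve : \forall n \near returns, (g - e)%:E <= root n.
  by apply: ev; rewrite lte_fin ltrBlDr ltrDl.
near=> n.
have rn : root n \is a fin_num by near: n.
have rg : root n <= g%:E by near: n.
have er : (g - e)%:E <= root n by near: n.
rewrite /= ler_norml; move: rg er; rewrite -(fineK rn) !lee_fin /= => *.
by apply/andP; split; lra.
Unshelve. all: by end_near. Qed.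

End Supermultiplicative.

(** * Powers of a nonnegative matrix and its spectral radius *)

Section MatrixPowers.
Local Open Scope ereal_scope.
Context {R : realType} {S : countType}.
Implicit Types (A B : S -> S -> R) (x y z : S).

Lemma matrix_pow_ge0 A n x y : nonnegative_matrix A -> 0 <= matrix_pow A n x y.
Proof.
move=> A0; elim: n x y => [|n IH] x y /=; first by case: eqP.
by apply: esum_ge0 => z _; apply: mule_ge0; rewrite ?lee_fin.
Qed.

Lemma matrix_powM A m n x z y : nonnegative_matrix A ->
  matrix_pow A m x z * matrix_pow A n z y <= matrix_pow A (m + n) x y.
Proof.
move=> A0; have mp0 k u v := matrix_pow_ge0 k u v A0.
elim: m x => [|m IH] x /=.
  by case: eqP => [->|_]; rewrite ?mul1e ?mul0e.
rewrite -esumZr//; last by move=> w; apply: mule_ge0; rewrite ?lee_fin.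
apply: le_esum => w _; rewrite -muleA.
by apply: lee_wpmul2l; rewrite ?lee_fin.
Qed.

Lemma matrix_pow_step A n x y z : nonnegative_matrix A ->
  (A x z)%:E * matrix_pow A n z y <= matrix_pow A n.+1 x y.
Proof.
move=> A0; apply: (esum_ge_term (a := fun z => (A x z)%:E * matrix_pow A n z y)) => //.
by move=> w _; apply: mule_ge0; rewrite ?lee_fin// matrix_pow_ge0.
Qed.

Lemma matrix_powS_gt0 A n x y : nonnegative_matrix A -> 0 < matrix_pow A n.+1 x y ->
  exists2 z, (0 < A x z)%R & 0 < matrix_pow A n z y.
Proof.
move=> A0 /= /esum_gt0P[z _ Az]; exists z.
  rewrite lt_neqAle A0 andbT; apply: contraTneq Az => <-.
  by rewrite mul0e ltxx.
rewrite lt_neqAle matrix_pow_ge0// andbT; apply: contraTneq Az => <-.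
by rewrite mule0 ltxx.
Qed.

Lemma matrix_pow_support A B n x y : nonnegative_matrix A -> nonnegative_matrix B ->
  (forall u v, 0 < A u v -> 0 < B u v)%R ->
  0 < matrix_pow A n x y -> 0 < matrix_pow B n x y.
Proof.
move=> A0 B0 AB; elim: n x => [//|n IH] x /(matrix_powS_gt0 A0)[z Az zy].
apply: lt_le_trans (matrix_pow_step _ _ _ z B0).
by apply: mule_gt0; [rewrite lte_fin AB|exact: IH].
Qed.

Lemma irreducible_support A B : nonnegative_matrix A -> nonnegative_matrix B ->
  (forall u v, 0 < A u v -> 0 < B u v)%R -> irreducible A -> irreducible B.
Proof.
move=> A0 B0 AB irr x y; have [n n1 nA] := irr x y.
by exists n => //; exact: matrix_pow_support nA.
Qed.

Definition growth_rate A x : \bar R := growth (fun n => matrix_pow A n x x).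

Section SpectralRadius.
Variable A : S -> S -> R.
Hypothesis A_ge0 : nonnegative_matrix A.
Hypothesis A_irr : irreducible A.

Let return_ge0 x n : 0 <= matrix_pow A n x x. Proof. exact: matrix_pow_ge0. Qed.
Let return0 x : matrix_pow A 0 x x = 1. Proof. by rewrite /= eqxx. Qed.
Let returnM x m n : matrix_pow A m x x * matrix_pow A n x x <= matrix_pow A (m + n) x x.
Proof. exact: matrix_powM. Qed.
Let return_gt0 x : exists n, 0 < matrix_pow A n.+1 x x.
Proof. by have [[//|n] _ nA] := A_irr x x; exists n. Qed.

Lemma growth_rate_ge0 x : 0 <= growth_rate A x.
Proof.
apply: le_trans (poweR_ge0 (matrix_pow A 1 x x) (1%:R^-1)%R) _.
by apply: ereal_sup_ubound; exists 0%N.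
Qed.

(** If the loops at [y] grew faster than [t ^+ n], then so would the loops at [x] that travel
    to [y], follow such loops there, and travel back. *)
Lemma bounded_return_transfer (t : R) x y : (0 <= t)%R ->
  (forall n, matrix_pow A n x x <= (t ^+ n)%:E) ->
  forall n, matrix_pow A n y y <= (t ^+ n)%:E.
Proof.
move=> t0 hx m; rewrite leNgt; apply/negP => tm.
have tpos : (0 < t)%R.
  rewrite lt_neqAle t0 andbT; apply/negP => /eqP t00.
  have [n xn] := return_gt0 x; have := hx n.+1.
  by rewrite -t00 expr0n/= leNgt xn.
have [k _ xy] := A_irr x y; have [l _ yx] := A_irr y x.
have c0 : 0 < matrix_pow A k x y * matrix_pow A l y x by exact: mule_gt0.
have [J hJ] := supermul_growth (return_ge0 y) (return0 y) (returnM y)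
  (t ^+ (k + l) + 1)%R tpos c0 tm.
have {hJ} := hJ J (leqnn J); apply/negP; rewrite -ltNge.
apply: (@le_lt_trans _ _ ((t ^+ (k + J * m + l))%:E)).
  apply: le_trans (hx _); apply: le_trans (matrix_powM _ _ _ y _ A_ge0).
  rewrite muleAC; apply: lee_wpmul2r; first exact: matrix_pow_ge0.
  exact: matrix_powM.
rewrite lte_fin addnAC exprD; have : (0 < t ^+ (J * m))%R by exact: exprn_gt0.
by set u := (t ^+ (J * m))%R; set v := (t ^+ (k + l))%R; nra.
Qed.

Lemma growth_rate_le x (t : R) : (0 <= t)%R ->
  growth_rate A x <= t%:E <-> forall n, matrix_pow A n x x <= (t ^+ n)%:E.
Proof. exact: growth_leP (return_ge0 x) (return0 x) t. Qed.

Lemma growth_rate_transfer x y : growth_rate A y <= growth_rate A x.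
Proof.
have := growth_rate_ge0 x; case gx: (growth_rate A x) => [t| |]// => [t0|_]; last exact: leey.
rewrite lee_fin in t0; apply/(growth_rate_le y t0).
apply: (bounded_return_transfer (x := x) y t0).
by apply/(growth_rate_le x t0); rewrite gx.
Qed.

(** All states have the same growth rate, so it is a common limit as in the definition of the
    spectral radius, and limits are unique. *)
Lemma spectral_radiusE x : spectral_radius A = growth_rate A x.
Proof.
have cvgx y : poweR (matrix_pow A n y y) (n%:R^-1)%R
    @[n --> within [set n | 0 < matrix_pow A n y y] \oo] --> growth_rate A y.
  exact: root_cvg (return_ge0 y) (return0 y) (returnM y) (return_gt0 y).
pose limits := [set r : \bar R | forall x,
  poweR (matrix_pow A n x x) (n%:R^-1)%R
    @[n --> within [set n | 0 < matrix_pow A n x x] \oo] --> r].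
have sr : limits (spectral_radius A).
  apply: (@getPex _ limits); exists (growth_rate A x) => y.
  have -> : growth_rate A x = growth_rate A y.
    by apply/eqP; rewrite eq_le !growth_rate_transfer.
  exact: cvgx.
have proper := returns_proper (return_ge0 x) (return0 x) (returnM x) (return_gt0 x).
exact: (cvg_unique (@ereal_hausdorff R) (sr x) (cvgx x)).
Qed.

Lemma spectral_radius_le x (t : R) : (0 <= t)%R ->
  spectral_radius A <= t%:E <-> forall n, matrix_pow A n x x <= (t ^+ n)%:E.
Proof. by move=> t0; rewrite (spectral_radiusE x); exact: growth_rate_le. Qed.

Lemma spectral_radius_gt0 (x : S) : 0 < spectral_radius A.
Proof.
rewrite ltNge; apply/negP => /(spectral_radius_le x (lexx _)) h.
have [n xn] := return_gt0 x; have := h n.+1.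
by rewrite expr0n/= leNgt xn.
Qed.

End SpectralRadius.
End MatrixPowers.

(** * First passages and the renewal equation *)

Section FirstPassage.
Local Open Scope ereal_scope.
Context {R : realType} {S : countType}.
Implicit Types (A B : S -> S -> R) (x y z w : S) (r : R).

(** The total weight of the paths of length [k.+1] from [y] to [x] that avoid [x] strictly in
    between; [k] counts the intermediate states. *)
Fixpoint first_passage A x k y : \bar R :=
  if k is k'.+1 then \esum_(z in [set~ x]) ((A y z)%:E * first_passage A x k' z)
  else (A y x)%:E.

Definition passage_gf A x r y : \bar R :=
  \esum_(k in [set: nat]) ((r ^+ k.+1)%:E * first_passage A x k y).

Definition green_gf A x r : \bar R :=
  \esum_(n in [set: nat]) ((r ^+ n)%:E * matrix_pow A n x x).

Section Renewal.
Variables (A : S -> S -> R) (x : S).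
Hypothesis A_ge0 : nonnegative_matrix A.

Lemma first_passage_ge0 k y : 0 <= first_passage A x k y.
Proof.
elim: k y => [|k IH] y /=; first by rewrite lee_fin.
by apply: esum_ge0 => z _; apply: mule_ge0; rewrite ?lee_fin.
Qed.
Let fp_ge0 := first_passage_ge0.
Let mp_ge0 n y z : 0 <= matrix_pow A n y z. Proof. exact: matrix_pow_ge0. Qed.

(** Split a path from [y] to [x] at its first arrival in [x]. *)
Lemma matrix_pow_renewal n y : matrix_pow A n.+1 y x =
  \sum_(k < n.+1) first_passage A x k y * matrix_pow A (n - k) x x.
Proof.
elim: n y => [|n IH] y.
  rewrite big_ord1 /= (esumD1 x); last first.
    by move=> z; apply: mule_ge0; rewrite ?lee_fin//; case: eqP.
  rewrite eqxx esum1 ?adde0 // => z /= zx; case: eqP => // _; by rewrite mule0.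
rewrite big_ord_recl subn0.
rewrite -[LHS]/(\esum_(z in [set: S]) ((A y z)%:E * matrix_pow A n.+1 z x)).
rewrite (esumD1 x); last by move=> z; apply: mule_ge0; rewrite ?lee_fin.
congr (_ + _).
rewrite (eq_esum (fun z _ => congr1 _ (IH z))).
rewrite (eq_esum (b := fun z => \sum_(k < n.+1)
   ((A y z)%:E * first_passage A x k z) * matrix_pow A (n - k) x x)); last first.
  move=> z _; rewrite ge0_sume_distrr; last by move=> k _; exact: mule_ge0.
  by apply: eq_bigr => k _; rewrite muleA.
have t_ge0 (k : 'I_n.+1) z : 0 <= (A y z)%:E * first_passage A x k z.
  by apply: mule_ge0; rewrite ?lee_fin.
rewrite esum_sum; last by move=> *; apply: mule_ge0.
by apply: eq_bigr => k _; rewrite esumZr.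
Qed.

Variable r : R.
Hypothesis r_ge0 : (0 <= r)%R.

Let u n := (r ^+ n)%:E * matrix_pow A n x x.
Let f k := (r ^+ k.+1)%:E * first_passage A x k x.
Let G n := \sum_(k < n) u k.

Let u_ge0 n : 0 <= u n. Proof. by apply: mule_ge0; rewrite ?lee_fin ?exprn_ge0. Qed.
Let f_ge0 n : 0 <= f n. Proof. by apply: mule_ge0; rewrite ?lee_fin ?exprn_ge0. Qed.
Let G_ge0 n : 0 <= G n. Proof. exact: sume_ge0. Qed.
Let u0 : u 0%N = 1. Proof. by rewrite /u /= eqxx mule1 expr0. Qed.

Let uS n : u n.+1 = \sum_(k < n.+1) f k * u (n - k)%N.
Proof.
rewrite /u matrix_pow_renewal ge0_sume_distrr; last by move=> *; exact: mule_ge0.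
apply: eq_bigr => k _; rewrite /f muleACA -EFinM -exprD addSn subnKC//.
by rewrite -ltnS.
Qed.

Let G_renewal n : G n.+1 = 1 + \sum_(k < n) f k * G (n - k)%N.
Proof.
elim: n => [|n IH]; first by rewrite /G big_ord1 big_ord0 adde0.
rewrite /G big_ord_recr /= -/(G _) IH uS -addeA; congr (_ + _).
rewrite (_ : \sum_(k < n) f k * G (n - k)%N = \sum_(k < n.+1) f k * G (n - k)%N); last first.
  by rewrite big_ord_recr /= subnn /G big_ord0 mule0 adde0.
rewrite -big_split /=; apply: eq_bigr => k _.
by rewrite -ge0_muleDr// subSn -1?ltnS// /G big_ord_recr.
Qed.

Let G_homo m n : (m <= n)%N -> G m <= G n.
Proof.
move=> /subnKC <-; elim: (n - m)%N => [|k IH]; first by rewrite addn0.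
by apply: le_trans IH _; rewrite addnS /G big_ord_recr /= leeDl.
Qed.

Let G_lower K n : 1 + (\sum_(k < K) f k) * G n <= G (n + K).+1.
Proof.
rewrite G_renewal; apply: leeD2l; rewrite addnC big_split_ord /=.
rewrite ge0_sume_distrl//; apply: le_trans (leeDl _ _); last first.
  by apply: sume_ge0 => k _; apply: mule_ge0.
apply: lee_sum => k _; apply: lee_wpmul2l => //; apply: G_homo.
rewrite addnC -addnBA ?leq_addr// ltnW//.
Qed.

Let G_upper n : G n <= 1 + passage_gf A x r x * G n.
Proof.
case: n => [|n]; first by rewrite /G big_ord0 mule0 adde0 lee01.
rewrite {1}G_renewal; apply: leeD2l.
apply: (@le_trans _ _ ((\sum_(k < n) f k) * G n.+1)).
  rewrite ge0_sume_distrl//; apply: lee_sum => k _; apply: lee_wpmul2l => //.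
  by apply: G_homo; apply: leq_trans (leq_subr _ _) _.
by apply: lee_wpmul2r => //; exact: le_esum_nat.
Qed.

(** The renewal equation writes each weighted term as a combination of earlier ones, with
    nonnegative coefficients of sum at most [1]. *)
Lemma weighted_return_le1 n : passage_gf A x r x <= 1 ->
  (r ^+ n)%:E * matrix_pow A n x x <= 1.
Proof.
move=> F1; rewrite -/(u n); elim/ltn_ind: n => -[_|n IH]; first by rewrite u0.
rewrite uS; apply: le_trans F1; apply: le_trans (le_esum_nat n.+1 f_ge0).
apply: lee_sum => k _; rewrite -[leRHS]mule1; apply: lee_wpmul2l => //.
by apply: IH; rewrite ltnS leq_subr.
Qed.

(** For [F < 1] the equation [G = 1 + F * G] has both [1 / (1 - F)] and [+oo] as solutions;
    its form [G n <= 1 + F * G n] for partial sums excludes the second. *)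
Lemma green_gf_lt_pinfty : (forall n, matrix_pow A n x x < +oo) ->
  passage_gf A x r x < 1 -> green_gf A x r < +oo.
Proof.
move=> fin F1.
have F0 : 0 <= passage_gf A x r x by apply: esum_ge0 => k _; exact: f_ge0.
have Fnum : passage_gf A x r x \is a fin_num.
  by rewrite ge0_fin_numE//; apply: lt_trans F1 (ltry _).
apply: (@le_lt_trans _ _ ((1 - fine (passage_gf A x r x))^-1)%:E); last exact: ltry.
apply: esum_nat_le => // n; rewrite -/(G n); have := G_upper n.
have Gnum : G n \is a fin_num.
  apply/sum_fin_numP => k _ _; rewrite fin_numM// ge0_fin_numE//.
move: F1; rewrite -(fineK Fnum) -(fineK Gnum) -EFinM -EFinD !lee_fin lte_fin /=.
move=> F1 GG; rewrite -[leRHS]mul1r ler_pdivlMr ?subr_gt0//; lra.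
Qed.

(** In the limit the renewal equation reads [G = 1 + F * G]; for [F = 1] no finite [G] solves
    it. *)
Lemma green_gf_pinfty : passage_gf A x r x = 1 -> green_gf A x r = +oo.
Proof.
move=> F1; apply/eqP; rewrite -leye_eq leNgt; apply/negP => Goo.
have Gge0 : 0 <= green_gf A x r by apply: esum_ge0 => k _; exact: u_ge0.
have Gnum : green_gf A x r \is a fin_num by rewrite ge0_fin_numE.
have : green_gf A x r <= green_gf A x r - 1.
  apply: esum_nat_le => // n; rewrite -/(G n).
  rewrite -[G n]mul1e -{1}F1 -esumZr//.
  apply: esum_nat_le => [k|K]; first by apply: mule_ge0 => //; exact: f_ge0.
  rewrite -ge0_sume_distrl; last by move=> k _; exact: f_ge0.
  rewrite leeBrDl//.
  by apply: le_trans (G_lower _ _) _; exact: le_esum_nat.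
by rewrite -(fineK Gnum) -EFinB lee_fin; lra.
Qed.

(** If finitely many terms of [F] already had sum [q > 1], the renewal equation would multiply
    the partial sums of the Green function by [q] every [K.+1] steps, whereas terms bounded by
    [1] allow only linear growth. *)
Lemma passage_gf_le1 : (forall n, (r ^+ n)%:E * matrix_pow A n x x <= 1) ->
  passage_gf A x r x <= 1.
Proof.
move=> u1; rewrite leNgt; apply/negP => /lt_esum_nat -/(_ f_ge0)[K FK].
have [q q1 qK] : exists2 q : R, (1 < q)%R & q%:E <= \sum_(k < K) f k.
  case: (\sum_(k < K) f k) FK => [s| |]//; last by exists 2%R; [lra|exact: leey].
  by rewrite lte_fin => s1; exists s.
have Gq j : (q ^+ j)%:E <= G (j * K.+1).+1.
  elim: j => [|j IH]; first by rewrite mul0n expr0 /G big_ord1 u0.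
  have -> : ((j.+1 * K.+1).+1 = ((j * K.+1).+1 + K).+1)%N by rewrite mulSn; lia.
  apply: le_trans (G_lower _ _); apply: le_trans (leeDr _ lee01).
  rewrite exprS EFinM; apply: lee_pmul => //; rewrite lee_fin ?exprn_ge0//; lra.
have Gn n : G n <= n%:R%:E.
  elim: n => [|n IH]; first by rewrite /G big_ord0.
  by rewrite /G big_ord_recr /= -natr1 EFinD; apply: leeD => //; exact: u1.
have [J hJ] := expr_ge_linear (K%:R + 3)%R q1.
have := le_trans (Gq J.+1) (Gn _); apply/negP; rewrite -ltNge lte_fin.
apply: lt_le_trans (hJ J.+1 (leqnSn J)).
rewrite -addn1 mulnC natrD natrM -[K.+1]addn1 natrD.
have : (1 <= J.+1%:R :> R)%R by rewrite ler1n.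
nra.
Qed.

End Renewal.
End FirstPassage.

(** * Generating functions of first passages *)

Section Convexity.
Local Open Scope ereal_scope.
Context {R : realType}.

Lemma expr_convex (t p q : R) n : (0 <= t <= 1)%R -> (0 <= p)%R -> (p <= q)%R ->
  (((1 - t) * p + t * q) ^+ n <= (1 - t) * p ^+ n + t * q ^+ n)%R.
Proof.
move=> /andP[t0 t1] p0 pq.
elim: n => [|n IH]; first by rewrite !expr0; lra.
have x0 : (0 <= (1 - t) * p + t * q)%R.
  by rewrite addr_ge0// mulr_ge0//; lra.
rewrite !exprS; apply: le_trans (ler_wpM2l x0 IH) _.
have : (p ^+ n <= q ^+ n)%R by apply: lerXn2r; rewrite ?nnegrE//; lra.
set u := (p ^+ n)%R; set v := (q ^+ n)%R => uv.
have : (0 <= t * (1 - t) * ((q - p) * (v - u)))%R.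
  by rewrite !mulr_ge0 ?subr_ge0.
lra.
Qed.

End Convexity.

Section PassageGf.
Local Open Scope ereal_scope.
Context {R : realType} {S : countType}.
Implicit Types (A B : S -> S -> R) (x y z w : S) (r : R).

Section OneMatrix.
Variables (A : S -> S -> R).
Hypothesis A_ge0 : nonnegative_matrix A.
Let fp_ge0 x k y : 0 <= first_passage A x k y. Proof. exact: first_passage_ge0. Qed.

Let term_ge0 x r y k : (0 <= r)%R -> 0 <= (r ^+ k.+1)%:E * first_passage A x k y.
Proof. by move=> r0; apply: mule_ge0; rewrite ?lee_fin ?exprn_ge0. Qed.

Lemma passage_gf_ge0 x r y : (0 <= r)%R -> 0 <= passage_gf A x r y.
Proof. by move=> r0; apply: esum_ge0 => k _; exact: term_ge0. Qed.

Lemma passage_gf_scale x r y (c : R) : (0 <= r)%R -> (1 <= c)%R ->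
  c%:E * passage_gf A x r y <= passage_gf A x (c * r) y.
Proof.
move=> r0 c1; have c0 : (0 <= c)%R by lra.
rewrite -esumZl ?lee_fin//; last by move=> k; exact: term_ge0.
apply: le_esum => k _; rewrite muleA; apply: lee_wpmul2r => //.
rewrite -EFinM lee_fin exprMn; apply: ler_wpM2r; first exact: exprn_ge0.
by rewrite exprS ler_peMr// exprn_ege1.
Qed.

(** Convexity in the radius keeps a power series that is below [1] at [r] and finite at [q] at
    most [1] slightly to the right of [r]. *)
Lemma passage_gf_beyond x r q : (0 <= r)%R -> (r < q)%R ->
  passage_gf A x r x < 1 -> passage_gf A x q x < +oo ->
  exists2 s, (r < s)%R & passage_gf A x s x <= 1.
Proof.
move=> r0 rq Fr Fq; have q0 : (0 <= q)%R by lra.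
have Fr0 := passage_gf_ge0 x x r0; have Fq0 := passage_gf_ge0 x x q0.
have : passage_gf A x r x \is a fin_num by rewrite ge0_fin_numE// (lt_trans Fr) ?ltry.
have : passage_gf A x q x \is a fin_num by rewrite ge0_fin_numE.
move=> /fineK; set b := fine _ => bE /fineK; set a := fine _ => aE.
move: Fr Fr0 Fq0; rewrite -aE -bE lte_fin !lee_fin => a1 a0 b0.
pose t := ((1 - a) / (2 + b))%R.
have b2 : (0 < 2 + b)%R by lra.
have t0 : (0 < t)%R by rewrite divr_gt0//; lra.
have t1 : (t < 1)%R by rewrite ltr_pdivrMr//; lra.
exists ((1 - t) * r + t * q)%R; first by nra.
apply: (@le_trans _ _ ((1 - t)%:E * passage_gf A x r x + t%:E * passage_gf A x q x)).
  have tge0 : 0 <= t%:E by rewrite lee_fin ltW.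
  have tge1 : 0 <= (1 - t)%:E by rewrite lee_fin subr_ge0 ltW.
  have term_r k := term_ge0 x x k r0; have term_q k := term_ge0 x x k q0.
  rewrite -!esumZl// -esumD; [|by move=> k _; exact: mule_ge0..].
  apply: le_esum => k _; rewrite !muleA -ge0_muleDl; last 2 first.
  - by rewrite -EFinM lee_fin mulr_ge0 ?exprn_ge0//; lra.
  - by rewrite -EFinM lee_fin mulr_ge0 ?exprn_ge0//; lra.
  apply: lee_wpmul2r => //; rewrite -!EFinM -EFinD lee_fin.
  by apply: expr_convex; lra.
rewrite -aE -bE -!EFinM -EFinD lee_fin.
have -> : ((1 - t) * a + t * b = a + t * (b - a))%R by ring.
have : (t * (b - a) <= t * (2 + b))%R by apply: ler_wpM2l; lra.
rewrite /t mulfVK ?gt_eqF//; lra.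
Qed.

Lemma passage_gf_first_step x r y : (0 <= r)%R -> passage_gf A x r y =
  (r * A y x)%:E + \esum_(z in [set~ x]) ((r * A y z)%:E * passage_gf A x r z).
Proof.
move=> r0; rewrite /passage_gf esum_natS; last by move=> k; exact: term_ge0.
rewrite expr1 -EFinM; congr (_ + _).
under [RHS]eq_esum => z _.
  rewrite -esumZl; [|by rewrite lee_fin mulr_ge0|by move=> k; exact: term_ge0].
  over.
rewrite esum_swap; last first.
  by move=> z k; apply: mule_ge0; [rewrite lee_fin mulr_ge0|exact: term_ge0].
apply: eq_esum => k _ /=; rewrite -esumZl ?lee_fin ?exprn_ge0//; last first.
  by move=> z; apply: mule_ge0; rewrite ?lee_fin.
by apply: eq_esum => z _; rewrite !muleA -!EFinM exprS mulrAC.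
Qed.

(** Where [passage_gf A x r x = 1] the special role of [x] in the first-step equation
    disappears, so that [passage_gf A x r] is an eigenvector of [A] for [r^-1]. *)
Lemma passage_gf_harmonic x r y : (0 <= r)%R -> passage_gf A x r x = 1 ->
  \esum_(z in [set: S]) ((r * A y z)%:E * passage_gf A x r z) = passage_gf A x r y.
Proof.
move=> r0 F1; rewrite (passage_gf_first_step x y r0) (esumD1 x); last first.
  by move=> z; apply: mule_ge0; rewrite ?lee_fin ?mulr_ge0 ?passage_gf_ge0.
by rewrite F1 mule1.
Qed.

Lemma passage_gf_superharmonic x r y w n : (0 <= r)%R -> passage_gf A x r x = 1 ->
  (r ^+ n)%:E * matrix_pow A n y w * passage_gf A x r w <= passage_gf A x r y.
Proof.
move=> r0 F1; have h0 z := passage_gf_ge0 x z r0.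
have mp0 k u v : 0 <= matrix_pow A k u v by exact: matrix_pow_ge0.
elim: n y => [|n IH] y /=.
  by case: eqP => [->|_]; rewrite expr0 mul1e ?mul1e// mul0e.
have step0 z : 0 <= (A y z)%:E * matrix_pow A n z w by apply: mule_ge0; rewrite ?lee_fin.
have rn0 : 0 <= (r ^+ n.+1)%:E by rewrite lee_fin exprn_ge0.
rewrite -(passage_gf_harmonic y r0 F1).
rewrite -(esumZl [set: S] (a := fun z => (A y z)%:E * matrix_pow A n z w))// -esumZr//; last first.
  by move=> z; exact: mule_ge0.
apply: le_esum => z _.
rewrite [leLHS](_ : _ = (r * A y z)%:E * ((r ^+ n)%:E * matrix_pow A n z w *
   passage_gf A x r w)); last first.
  by rewrite exprS !muleA -!EFinM mulrAC.
by apply: lee_wpmul2l => //; rewrite lee_fin mulr_ge0.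
Qed.

Hypothesis A_irr : irreducible A.

Lemma passage_gf_gt0 x r y : (0 < r)%R -> passage_gf A x r x = 1 -> 0 < passage_gf A x r y.
Proof.
move=> r0 F1; have [n _ yx] := A_irr y x.
apply: lt_le_trans (passage_gf_superharmonic y x n (ltW r0) F1).
by rewrite F1 mule1; apply: mule_gt0 => //; rewrite lte_fin exprn_gt0.
Qed.

Lemma passage_gf_lt_pinfty x r y : (0 < r)%R -> passage_gf A x r x = 1 ->
  passage_gf A x r y < +oo.
Proof.
move=> r0 F1; have [n _ xy] := A_irr x y.
have := passage_gf_superharmonic x y n (ltW r0) F1; rewrite F1.
rewrite ltey; apply: contraTneq => ->; rewrite gt0_muley ?leNgt ?ltry//.
by apply: mule_gt0 => //; rewrite lte_fin exprn_gt0.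
Qed.

(** With [passage_gf_le1_invr] this locates the spectral radius: [spectral_radius A <= r^-1]
    holds exactly when the first-return generating function at [r] is at most [1]. *)
Lemma spectral_radius_le_invr x r : (0 < r)%R -> passage_gf A x r x <= 1 ->
  spectral_radius A <= (r^-1)%:E.
Proof.
move=> r0 F1; have ri0 : (0 <= r^-1)%R by rewrite invr_ge0 ltW.
apply/(spectral_radius_le A_ge0 A_irr x ri0).
move=> n; have := weighted_return_le1 A_ge0 (ltW r0) n F1.
rewrite muleC -lee_pdivlMr ?exprn_gt0// mul1e exprVn//.
Qed.

Lemma passage_gf_le1_invr x r : (0 < r)%R -> spectral_radius A <= (r^-1)%:E ->
  passage_gf A x r x <= 1.
Proof.
move=> r0; have ri0 : (0 <= r^-1)%R by rewrite invr_ge0 ltW.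
move=> /(spectral_radius_le A_ge0 A_irr x ri0) h.
apply: passage_gf_le1 => //; first exact: ltW.
move=> n; rewrite muleC -lee_pdivlMr ?exprn_gt0// mul1e -exprVn.
exact: h.
Qed.

Lemma matrix_pow_lt_pinfty x n : spectral_radius A < +oo -> matrix_pow A n x x < +oo.
Proof.
move=> s; have s0 := spectral_radius_gt0 A_ge0 A_irr x.
have /fineK sE : spectral_radius A \is a fin_num by rewrite ge0_fin_numE// ltW.
apply: le_lt_trans (ltry (fine (spectral_radius A) ^+ n)).
have f0 : (0 <= fine (spectral_radius A))%R by rewrite fine_ge0// ltW.
suff /(spectral_radius_le A_ge0 A_irr x f0) h :
    spectral_radius A <= (fine (spectral_radius A))%:E by exact: h.
by rewrite sE.
Qed.

(** Divergence of the Green function does not depend on the state: excursions to another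
    state and back cost only constant factors. *)
Lemma passage_gf_eq1 x w r : (0 < r)%R -> spectral_radius A <= (r^-1)%:E ->
  passage_gf A x r x = 1 -> passage_gf A w r w = 1.
Proof.
move=> r0 sr F1; have s := le_lt_trans sr (ltry _).
apply/eqP; rewrite eq_le passage_gf_le1_invr//= leNgt; apply/negP => Fw.
have := green_gf_lt_pinfty A_ge0 (ltW r0) (fun n => matrix_pow_lt_pinfty w n s) Fw.
apply/negP; rewrite -leNgt leye_eq; apply/eqP.
have [k _ wx] := A_irr w x; have [l _ xw] := A_irr x w.
have mp0 m u v : 0 <= matrix_pow A m u v by exact: matrix_pow_ge0.
have rn m : (0 <= r ^+ m)%R by rewrite exprn_ge0 ?ltW.
pose c := (r ^+ (k + l))%:E * (matrix_pow A k w x * matrix_pow A l x w).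
have c0 : 0 < c by apply: mule_gt0; [rewrite lte_fin exprn_gt0|exact: mule_gt0].
apply/eqP; rewrite -leye_eq -(gt0_muley c0) -(green_gf_pinfty A_ge0 (ltW r0) F1).
rewrite -esumZl; last 2 first.
- exact: ltW.
- by move=> n; apply: mule_ge0; rewrite ?lee_fin.
apply: le_trans (esum_nat_shift (k + l) _) => [|n]; last first.
  by apply: mule_ge0; rewrite ?lee_fin.
apply: le_esum => n _; rewrite /c muleACA -EFinM -exprD.
apply: lee_wpmul2l; first by rewrite lee_fin.
rewrite addnAC; apply: le_trans (matrix_powM _ _ _ x _ A_ge0).
rewrite muleAC; apply: lee_wpmul2r => //; exact: matrix_powM.
Qed.

End OneMatrix.

Section TwoMatrices.
Variables A B : S -> S -> R.
Hypothesis A_ge0 : nonnegative_matrix A.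
Hypothesis B_ge0 : nonnegative_matrix B.

Lemma first_passage_le x k y : (forall u v, B u v <= A u v)%R ->
  first_passage B x k y <= first_passage A x k y.
Proof.
move=> BA; elim: k y => [|k IH] y /=; first by rewrite lee_fin.
by apply: le_esum => z _; apply: lee_pmul; rewrite ?lee_fin// first_passage_ge0.
Qed.

Lemma passage_gf_le x r y : (forall u v, B u v <= A u v)%R -> (0 <= r)%R ->
  passage_gf B x r y <= passage_gf A x r y.
Proof.
move=> BA r0; apply: le_esum => k _; apply: lee_wpmul2l; rewrite ?lee_fin ?exprn_ge0//.
exact: first_passage_le.
Qed.

(** A first-return loop at [x] uses row [x] only at its first step; hence multiplying that row
    by [c] multiplies the weight of such loops by [c] only. *)
Lemma passage_gf_row_change x r (c : R) : (0 <= c)%R -> (0 <= r)%R ->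
  (forall y z, y <> x -> A y z = B y z) -> (forall z, A x z <= c * B x z)%R ->
  passage_gf A x r x <= c%:E * passage_gf B x r x.
Proof.
move=> c0 r0 rows row_x.
have eq_fp k y : y <> x -> first_passage A x k y = first_passage B x k y.
  elim: k y => [|k IH] y yx /=; first by rewrite rows.
  by apply: eq_esum => z zx; rewrite rows// IH.
have fpB0 k y : 0 <= first_passage B x k y by exact: first_passage_ge0.
rewrite -esumZl ?lee_fin//; last first.
  by move=> k; apply: mule_ge0; rewrite ?lee_fin ?exprn_ge0.
apply: le_esum => k _; rewrite muleCA; apply: lee_wpmul2l; rewrite ?lee_fin ?exprn_ge0//.
case: k => [|k] /=; first by rewrite -EFinM lee_fin.
rewrite -esumZl ?lee_fin//; last by move=> z; apply: mule_ge0; rewrite ?lee_fin.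
apply: le_esum => z zx; rewrite eq_fp// muleA; apply: lee_wpmul2r => //.
by rewrite -EFinM lee_fin.
Qed.

(** Let [h_A] and [h_B] be [passage_gf A x r] and [passage_gf B x r]. Both are harmonic for their
    matrix, and [h_B <= h_A] with equality at [x]. Equality
    spreads along every edge leaving a point of equality, and forces the weight of that
    edge to agree. *)
Lemma passage_gf_rigid x r : (0 < r)%R -> irreducible B ->
  (forall u v, B u v <= A u v)%R -> (forall u v, 0 < B u v <-> 0 < A u v)%R ->
  passage_gf A x r x = 1 -> passage_gf B x r x = 1 -> B = A.
Proof.
move=> r0 Birr BA supp FA FB; have r0' := ltW r0.
have Airr : irreducible A by apply: irreducible_support Birr => // u v /supp.
have hle z : passage_gf B x r z <= passage_gf A x r z by exact: passage_gf_le.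
have hB0 z := passage_gf_gt0 B_ge0 Birr z r0 FB.
have hAoo z := passage_gf_lt_pinfty A_ge0 Airr z r0 FA.
have edge y : passage_gf B x r y = passage_gf A x r y -> forall z,
    (r * B y z)%:E * passage_gf B x r z = (r * A y z)%:E * passage_gf A x r z.
  move=> hy; apply: eq_esum_term.
  - by move=> z; apply: mule_ge0; rewrite ?lee_fin ?mulr_ge0// ltW.
  - move=> z; apply: lee_pmul => //; rewrite ?lee_fin ?mulr_ge0//; first exact: ltW.
    exact: ler_wpM2l.
  - by rewrite !passage_gf_harmonic// hy.
  - by rewrite passage_gf_harmonic.
have edgeP y z : passage_gf B x r y = passage_gf A x r y -> (0 < B y z)%R ->
    passage_gf B x r z = passage_gf A x r z /\ B y z = A y z.
  move=> hy Byz; have := edge y hy z; have := hAoo z; have := hle z; have := hB0 z.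
  have := BA y z; move: Byz.
  case: (passage_gf B x r z) => [p| |]; case: (passage_gf A x r z) => [q| |]//.
  rewrite -!EFinM !lte_fin !lee_fin => b0 ba p0 pq _ [].
  rewrite -!mulrA => /(mulfI (lt0r_neq0 r0)) e.
  have e1 : p = q by nra.
  by split; [rewrite e1|move: e; rewrite e1; apply: mulIf; rewrite gt_eqF// -e1].
have spread n v y : 0 < matrix_pow B n v y ->
    passage_gf B x r v = passage_gf A x r v -> passage_gf B x r y = passage_gf A x r y.
  elim: n v => [|n IH] v.
    by rewrite /=; case: eqP => [->|_] //; rewrite ltxx.
  move=> /(matrix_powS_gt0 B_ge0)[z vz zy] hv.
  by have [hz _] := edgeP v z hv vz; exact: IH zy hz.
have all_eq y : passage_gf B x r y = passage_gf A x r y.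
  by have [n _ xy] := Birr x y; apply: spread xy _; rewrite FA.
apply/funext => u; apply/funext => v.
have [Buv|Buv] := ltP 0%R (B u v); first by have [] := edgeP u v (all_eq u) Buv.
have Auv : (A u v <= 0)%R.
  by rewrite leNgt; apply/negP => /supp; rewrite ltNge Buv.
by apply/eqP; rewrite eq_le BA/= (le_trans Auv).
Qed.
End TwoMatrices.
End PassageGf.

(** * Doob transforms *)

Section Transform.
Local Open Scope ereal_scope.
Context {R : realType} {S : countType}.
Variables (A : S -> S -> R) (h : S -> R) (c : R).
Hypothesis A_ge0 : nonnegative_matrix A.
Hypothesis h_gt0 : forall x, (0 < h x)%R.
Hypothesis c_gt0 : (0 < c)%R.

Definition h_transform x y := (c^-1 * (h x)^-1 * A x y * h y)%R.

Lemma h_transform_ge0 : nonnegative_matrix h_transform.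
Proof.
by move=> x y; rewrite /h_transform !mulr_ge0 ?invr_ge0 ?(ltW (h_gt0 _)) ?(ltW c_gt0).
Qed.

Lemma h_transform_irreducible : irreducible A -> irreducible h_transform.
Proof.
apply: irreducible_support => //; first exact: h_transform_ge0.
by move=> u v Auv; rewrite /h_transform !mulr_gt0 ?invr_gt0.
Qed.

(** Along a path the factors [h] telescope to those of its two ends. *)
Lemma first_passage_h_transform x k y : first_passage h_transform x k y =
  (c^-1 ^+ k.+1 * (h y)^-1 * h x)%:E * first_passage A x k y.
Proof.
elim: k y => [|k IH] y /=.
  by rewrite -EFinM expr1 /h_transform; congr (_%:E); ring.
have w0 z k' : (0 <= c^-1 ^+ k' * (h z)^-1 * h x)%R.
  by rewrite !mulr_ge0 ?exprn_ge0 ?invr_ge0 ?(ltW (h_gt0 _)) ?(ltW c_gt0).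
rewrite -esumZl; last 2 first.
- by rewrite lee_fin.
- by move=> z; apply: mule_ge0; rewrite ?lee_fin// first_passage_ge0.
apply: eq_esum => z _; rewrite IH !muleA -!EFinM; congr (_%:E * _).
rewrite /h_transform [in RHS]exprS; have := lt0r_neq0 (h_gt0 z).
move=> hz; set q := (c^-1 ^+ k.+1)%R; field.
by rewrite hz !lt0r_neq0.
Qed.

Lemma passage_gf_h_transform x (s : R) :
  passage_gf h_transform x s x = passage_gf A x (s / c) x.
Proof.
apply: eq_esum => k _; rewrite first_passage_h_transform muleA -EFinM.
by rewrite mulfVK ?gt_eqF// -exprMn.
Qed.

End Transform.

(** * The law of the first return time *)

Section FirstReturnLaw.
Local Open Scope ereal_scope.
Context {R : realType} {S : countType}.
Variables (P : S -> S -> R) (x : S).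
Hypothesis P_ge0 : nonnegative_matrix P.
Variables (d : measure_display) (T : measurableType d) (Pr : probability T R).
Variable X : nat -> T -> S.
Hypothesis chain : markov_chain P x Pr X.

Let meas_X n y : measurable (X n @^-1` [set y]). Proof. by have [] := chain. Qed.

Lemma probability_decompose n (D : set T) : measurable D ->
  Pr D = \esum_(z in [set: S]) Pr (D `&` X n @^-1` [set z]).
Proof.
move=> mD; pose F i := D `&` [set w | pickle (X n w) = i].
have FE z : F (pickle z) = D `&` X n @^-1` [set z].
  rewrite /F; congr (_ `&` _); apply/seteqP; split=> w /=; last by move->.
  by move/(pcan_inj pickleK).
have Fnil i : ~ (exists z : S, pickle z = i) -> F i = set0.
  by move=> no; apply/seteqP; split=> // w [_ /= e]; apply: no; exists (X n w).
have mF i : measurable (F i).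
  have [[z <-]|/Fnil ->] := pselect (exists z : S, pickle z = i); last exact: measurable0.
  by rewrite FE; exact: measurableI.
rewrite [in LHS](_ : D = \bigcup_i F i); last first.
  by apply/seteqP; split=> [w Dw|w [i _ []]//]; exists (pickle (X n w)).
rewrite measure_semi_bigcup//; last 2 first.
- apply/trivIsetP => i j _ _ /eqP ij; apply/seteqP; split=> // w [[_ /= e1] [_ /= e2]].
  by apply: ij; rewrite -e1.
- exact: bigcup_measurable.
rewrite nneseries_esumT// (@esum_pickle _ S) => [|i /Fnil ->]; last exact: measure0.
by apply: eq_esum => z _; rewrite FE.
Qed.

Let cylinder (s : nat -> S) m := [set w | forall k, (k <= m)%N -> X k w = s k].
Let upd (s : nat -> S) m z k := if k == m.+1 then z else s k.
Let hit s m k := cylinder s m `&`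
  [set w | (forall i, (m < i <= m + k)%N -> X i w <> x) /\ X (m + k).+1 w = x].

Let meas_avoid m k : measurable [set w | forall i, (m < i <= m + k)%N -> X i w <> x].
Proof.
rewrite (_ : [set w | _] = \bigcap_i (if (m < i <= m + k)%N then ~` (X i @^-1` [set x]) else setT)).
  by apply: bigcapT_measurable => i; case: ifP => // _; exact: measurableC.
apply/seteqP; split=> w /= h i; first by move=> _; case: ifP => // ib; exact: h.
by move=> ib; have := h i I; rewrite ib.
Qed.

Let meas_cylinder s m : measurable (cylinder s m).
Proof.
rewrite (_ : cylinder s m = \bigcap_i (if (i <= m)%N then X i @^-1` [set s i] else setT)).
  by apply: bigcapT_measurable => i; case: ifP.
apply/seteqP; split=> w /= h i; first by move=> _; case: ifP => // ib; exact: h.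
by move=> ib; have := h i I; rewrite ib.
Qed.

Let meas_hit s m k : measurable (hit s m k).
Proof.
apply: measurableI => //; apply: (@measurableI _ _ _ (X (m + k).+1 @^-1` [set x])) => //.
exact: meas_avoid.
Qed.

Let cylinder_upd s m z : cylinder (upd s m z) m.+1 = cylinder s m `&` X m.+1 @^-1` [set z].
Proof.
apply/seteqP; split=> w /=.
  move=> h; split=> [k km|]; first by rewrite h ?(leqW km)// /upd ltn_eqF.
  by rewrite h// /upd eqxx.
move=> [h hz] k; rewrite leq_eqVlt /upd => /orP[/eqP -> |km]; first by rewrite eqxx.
by rewrite ltn_eqF// h.
Qed.

Let Pr_cylinder_upd s m z : Pr (cylinder (upd s m z) m.+1) = Pr (cylinder s m) * (P (s m) z)%:E.
Proof.
have [_ _ /(_ m (upd s m z))] := chain; rewrite -/(cylinder _ _) => ->.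
have -> : [set w | forall k, (k <= m)%N -> X k w = upd s m z k] = cylinder s m.
  by apply/seteqP; split=> w /= h k km; have := h k km; rewrite /upd ltn_eqF.
by rewrite /upd eqxx ltn_eqF.
Qed.

(** Summing over the position after the first unconstrained step reduces the law of the
    hitting time to the recursion that defines the first-passage weights. *)
Let Pr_hit k s m : Pr (hit s m k) = Pr (cylinder s m) * first_passage P x k (s m).
Proof.
elim: k s m => [|k IH] s m.
  rewrite /= -Pr_cylinder_upd cylinder_upd /hit addn0; congr (Pr _).
  apply/seteqP; split=> w; first by move=> [h [_ hx]].
  by move=> [h hx]; split=> //; split=> // i /andP[mi]; rewrite leqNgt mi.
rewrite (probability_decompose m.+1 (meas_hit s m k.+1)) /=.
rewrite (esumD1 x) => [|z]; last exact: measure_ge0.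
rewrite (_ : hit s m k.+1 `&` _ = set0) ?measure0 ?add0e; last first.
  apply/seteqP; split=> // w [[_ [/(_ m.+1)]]] /= h _ hx; apply: h => //.
  by rewrite ltnSn addnS ltnS leq_addr.
rewrite -esumZl ?measure_ge0//; last first.
  by move=> z; apply: mule_ge0; rewrite ?lee_fin// first_passage_ge0.
apply: eq_esum => z /= zx.
have -> : hit s m k.+1 `&` X m.+1 @^-1` [set z] = hit (upd s m z) m.+1 k.
  rewrite /hit cylinder_upd addSnnS; apply/seteqP; split=> w /=.
    move=> [[h [hx xx]] hz]; split=> //; split=> // i /andP[mi ik].
    by apply: hx; rewrite ik (ltnW mi).
  move=> [[h hz] [hx xx]]; split=> //; split=> //; split=> // i /andP[].
  rewrite leq_eqVlt => /orP[/eqP <- _|mi ik]; first by rewrite hz.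
  by apply: hx; rewrite mi.
by rewrite IH Pr_cylinder_upd /upd eqxx muleA.
Qed.

Definition return_at k :=
  [set w | (forall i, (0 < i <= k)%N -> X i w <> x) /\ X k.+1 w = x].

Let meas_return k : measurable (return_at k).
Proof.
have := meas_avoid 0 k; rewrite add0n => av.
by have := measurableI _ _ av (meas_X k.+1 x).
Qed.

Let Pr_return k : Pr (return_at k) = first_passage P x k x.
Proof.
have [_ X0 _] := chain.
have := Pr_hit k (fun=> x) 0.
have c0 : cylinder (fun=> x) 0 = [set w | X 0 w = x].
  by apply/seteqP; split=> w /=; [exact|move=> h k'; rewrite leqn0 => /eqP ->].
rewrite c0 X0 mul1e /hit c0 => <-; rewrite -/(return_at k).
have mX0 : measurable [set w | X 0 w = x] by exact: meas_X.
have nC : Pr (~` [set w | X 0 w = x]) = 0 by rewrite probability_setC// X0 subee.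
apply/eqP; rewrite eq_le; apply/andP; split; last first.
  by apply: le_measure; rewrite ?inE//; exact: measurableI.
rewrite -[leRHS]adde0 -nC.
apply: le_trans (measureU2 _ _ _); rewrite ?inE; [|exact: measurableI|exact: measurableC].
apply: le_measure; rewrite ?inE//.
  by apply: measurableU; [exact: measurableI|exact: measurableC].
by move=> w rw; have [e|ne] := pselect (X 0 w = x); [left|right].
Qed.

Let first_return_at k w : return_at k w -> first_return X x w = (k.+1%:R)%:E :> \bar R.
Proof.
move=> [no back]; apply/eqP; rewrite eq_le; apply/andP; split.
  by apply: ereal_inf_lbound; exists k.+1.
apply: le_ereal_inf_tmp => _ [j [j0 jx] <-]; rewrite lee_fin ler_nat.
rewrite ltnNge; apply/negP => jk; apply: (no j) => //; by rewrite j0.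
Qed.

Let first_return_lt w : first_return X x w < +oo :> \bar R <-> (\bigcup_k return_at k) w.
Proof.
split=> [|[k _ /first_return_at ->]]; last exact: ltry.
move=> /ereal_inf_lt[_ [k [k0 kx] <-] _].
have ex : exists k, (0 < k)%N && (X k w == x) by exists k; rewrite k0; apply/eqP.
case: (ex_minnP ex) => -[//|m] /andP[_ /eqP mx] mmin; exists m => //; split=> // i /andP[i0 im] ix.
have := mmin i; rewrite i0 ix eqxx => /(_ isT); by rewrite leqNgt ltnS im.
Qed.

Let return_triv : trivIset setT return_at.
Proof.
apply/trivIsetP => i j _ _ /eqP ij; apply/seteqP; split=> // w [ri rj].
apply: ij; have := first_return_at ri; rewrite (first_return_at rj) => -[/eqP].
by rewrite eqr_nat => /eqP[].
Qed.

Lemma prob_return : Pr [set w | first_return X x w < +oo :> \bar R] = passage_gf P x 1 x.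
Proof.
have -> : [set w | first_return X x w < +oo :> \bar R] = \bigcup_k return_at k.
  by apply/seteqP; split=> w /= /first_return_lt.
rewrite measure_semi_bigcup//; last exact: bigcup_measurable.
rewrite nneseries_esumT//; apply: eq_esum => k _.
by rewrite expr1n mul1e; exact: Pr_return.
Qed.

Lemma expectation_return (e : R) : passage_gf P x 1 x = 1 ->
  \int[Pr]_(w in [set: T]) expeR (e%:E * first_return X x w) = passage_gf P x (expR e) x.
Proof.
move=> F1; set f := fun w => expeR _; pose D := \bigcup_k return_at k.
have mD : measurable D by exact: bigcup_measurable.
have PD : Pr D = 1.
  rewrite -F1 -prob_return; congr (Pr _).
  by apply/seteqP; split=> w /= /first_return_lt.
have PDC : Pr (~` D) = 0 by rewrite probability_setC// PD subee.
have fk k w : return_at k w -> f w = (expR e ^+ k.+1)%:E.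
  by move=> /first_return_at rk; rewrite /f rk -EFinM /= mulrC -expRM_natl mulrC.
have f0 w : 0 <= f w by exact: expeR_ge0.
have mfk k : measurable_fun (return_at k) f.
  apply: (eq_measurable_fun (cst (expR e ^+ k.+1)%:E)) => // w /set_mem rw.
  by rewrite (fk _ _ rw).
have mfD : measurable_fun D f by apply/measurable_fun_bigcup.
have mfC : measurable_fun (~` D) f.
  apply: (eq_measurable_fun (cst (expeR (e%:E * +oo)))) => // w /set_mem nw.
  rewrite /f; congr (expeR (_ * _)); apply/eqP; rewrite eq_sym -leye_eq leNgt.
  by apply/negP => /first_return_lt.
rewrite -(setUv D) (ge0_integral_setU _ mD (measurableC mD)); last 3 first.
- by apply/measurable_funU => //; exact: measurableC.
- by move=> w _; exact: expeR_ge0.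
- by apply/disj_setPS => w [].
rewrite (null_set_integral (measurableC mD) mfC PDC) adde0.
rewrite ge0_integral_bigcup//; last by move=> w _; exact: f0.
rewrite nneseries_esumT; last by move=> k; apply: integral_ge0 => w _; exact: f0.
apply: eq_esum => k _.
rewrite (eq_integral (cst (expR e ^+ k.+1)%:E)); last by move=> w /set_mem /fk.
by rewrite integral_cst//; congr (_ * _); exact: Pr_return.
Qed.

End FirstReturnLaw.

(** * A Markov chain on the unit interval *)

Section UnitInterval.
Local Open Scope ereal_scope.
Context {R : realType}.

Definition unit_interval_measure : set (measurableTypeR R) -> \bar R :=
  mrestr lebesgue_measure (measurable_itv `[0%R, 1%R[).

HB.instance Definition _ := Measure.on unit_interval_measure.

Let unit_interval_setT : unit_interval_measure [set: _] = 1.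
Proof.
by rewrite /unit_interval_measure /mrestr setTI lebesgue_measure_itv /= lte_fin ltr01 oppr0 adde0.
Qed.

HB.instance Definition _ :=
  @Measure_isProbability.Build _ _ R unit_interval_measure unit_interval_setT.

End UnitInterval.

Section ChainConstruction.
Local Open Scope ereal_scope.
Context {R : realType} {S : countType}.
Variables (P : S -> S -> R) (x0 : S).
Hypothesis P_kernel : is_probability_kernel P.

Let P_ge0 x y : (0 <= P x y)%R. Proof. by have [] := P_kernel. Qed.

(** A row of [P] listed along the encoding of [S] by natural numbers; codes of no state get
    weight [0]. *)
Definition coded_row x i : R := if @pickle_inv S i is Some y then P x y else 0%R.
Definition row_cdf x n : R := (\sum_(i < n) coded_row x i)%R.

Let coded_row_ge0 x i : (0 <= coded_row x i)%R.
Proof. by rewrite /coded_row; case: pickle_inv. Qed.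

Let coded_row_pickle x y : coded_row x (pickle y) = P x y.
Proof. by rewrite /coded_row pickleK_inv. Qed.

Let row_cdf_S x n : row_cdf x n.+1 = (row_cdf x n + coded_row x n)%R.
Proof. by rewrite /row_cdf big_ord_recr. Qed.

Let row_cdf_homo x m n : (m <= n)%N -> (row_cdf x m <= row_cdf x n)%R.
Proof.
move=> /subnKC <-; elim: (n - m)%N => [|k IH]; first by rewrite addn0.
by rewrite addnS row_cdf_S (le_trans IH)// lerDl.
Qed.

Let row_cdf_ge0 x n : (0 <= row_cdf x n)%R. Proof. exact: sumr_ge0. Qed.

Let total x : \esum_(i in [set: nat]) (coded_row x i)%:E = 1.
Proof.
have [_ /(_ x) <-] := P_kernel; rewrite (@esum_pickle _ S).
  by apply: eq_esum => y _; rewrite coded_row_pickle.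
move=> i no; rewrite /coded_row; case e: pickle_inv => [y|//].
by exfalso; apply: no; exists y; have := @pickle_invK S i; rewrite e.
Qed.

Let row_cdf_le1 x n : (row_cdf x n <= 1)%R.
Proof.
rewrite -lee_fin -(total x) /row_cdf -sumEFin.
by apply: (@le_esum_nat _ (fun i => (coded_row x i)%:E)) => k; rewrite lee_fin.
Qed.

Let row_cdf_exceeds x u : (u < 1)%R -> exists n, (u < row_cdf x n)%R.
Proof.
rewrite -lte_fin -(total x) => /lt_esum_nat[k|n]; first by rewrite lee_fin.
by rewrite sumEFin lte_fin; exists n.
Qed.

Definition selects x u y := (row_cdf x (pickle y) <= u < row_cdf x (pickle y) + P x y)%R.

Let selects_ex x u : (0 <= u < 1)%R -> exists y, selects x u y.
Proof.
move=> /andP[u0 u1]; have [n0 hn0] := row_cdf_exceeds x u1.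
have ex : exists n, (u < row_cdf x n)%R by exists n0.
case: (ex_minnP ex) => -[|n] un nmin.
  by move: un; rewrite /row_cdf big_ord0 ltNge u0.
have cu : (row_cdf x n <= u)%R.
  by rewrite leNgt; apply/negP => /nmin; rewrite ltnn.
have : (0 < coded_row x n)%R.
  by rewrite -(ltrD2l (row_cdf x n)) addr0 -row_cdf_S (le_lt_trans cu).
move: un; rewrite row_cdf_S /coded_row; case e: pickle_inv => [y|]; last by rewrite ltxx.
have ny : pickle y = n by have := @pickle_invK S n; rewrite e.
by move=> un _; exists y; rewrite /selects ny cu.
Qed.

Let selects_uniq x u y z : selects x u y -> selects x u z -> y = z.
Proof.
move=> /andP[cy uy] /andP[cz uz]; apply: (pcan_inj pickleK).
apply/eqP; rewrite eqn_leq; apply/andP; split; rewrite leqNgt; apply/negP.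
- move/(row_cdf_homo x); rewrite row_cdf_S coded_row_pickle => h.
  by have := lt_le_trans uz (le_trans h cy); rewrite ltxx.
- move/(row_cdf_homo x); rewrite row_cdf_S coded_row_pickle => h.
  by have := lt_le_trans uy (le_trans h cz); rewrite ltxx.
Qed.

(** A uniform variable chooses the successor whose share of the unit interval contains it; its
    relative position inside that share is again uniform and drives the next step. *)
Definition chain_step (p : S * R) : S * R :=
  let y := xget p.1 [set y | selects p.1 p.2 y] in
  (y, (p.2 - row_cdf p.1 (pickle y)) / P p.1 y)%R.

Let state n w := iter n chain_step (x0, w).

(** If [s 0 = x0], the points of the unit interval that produce the path [s] up to time [n] form
    the interval with left end [path_start s n] and length [path_weight s n]. *)
Definition path_weight (s : nat -> S) n : R := (\prod_(i < n) P (s i) (s i.+1))%R.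

Fixpoint path_start (s : nat -> S) n : R :=
  if n is m.+1 then (path_start s m +
    path_weight s m * row_cdf (s m) (pickle (s m.+1)))%R
  else 0%R.

Let cell (s : nat -> S) n : set R :=
  `[path_start s n, (path_start s n + path_weight s n)%R[%classic.

Let len_ge0 s n : (0 <= path_weight s n)%R. Proof. exact: prodr_ge0. Qed.

Let lenS s n : path_weight s n.+1 = (path_weight s n * P (s n) (s n.+1))%R.
Proof. by rewrite /path_weight big_ord_recr. Qed.

Let cell_sub s n : cell s n.+1 `<=` cell s n.
Proof.
move=> w; rewrite /cell /= !in_itv /= lenS => /andP[lw wr]; apply/andP; split.
  by apply: le_trans lw; rewrite lerDl; apply: mulr_ge0; [exact: len_ge0|exact: row_cdf_ge0].
apply: lt_le_trans wr _; rewrite -/(path_weight s n) -addrA lerD2l -mulrDr ler_piMr//.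
by rewrite -coded_row_pickle -row_cdf_S.
Qed.

Let cell_len s n w : cell s n w -> (0 < path_weight s n)%R.
Proof.
rewrite /cell /= in_itv/= => /andP[lw wr].
by rewrite -(ltrD2l (path_start s n)) addr0 (le_lt_trans lw).
Qed.

Let cell_selects s n w : cell s n w ->
  selects (s n) ((w - path_start s n) / path_weight s n)%R (s n.+1) <-> cell s n.+1 w.
Proof.
move=> cw; have l0 := cell_len cw; rewrite /selects /cell /= in_itv /= lenS.
rewrite ler_pdivlMr// ltr_pdivrMr// lerBrDl ltrBlDl mulrDl addrA.
by rewrite ![(_ * path_weight s n)%R]mulrC.
Qed.

(** Inside the cell of a path the second component of the state is the relative position of
    [w]; both facts are proved together because each step of one needs the other. *)
Let state_cell s n w : s 0%N = x0 -> (0 <= w < 1)%R ->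
  ((forall k, (k <= n)%N -> (state k w).1 = s k) <-> cell s n w) /\
  (cell s n w -> (state n w).2 = ((w - path_start s n) / path_weight s n)%R).
Proof.
move=> s0 w01; elim: n => [|n [IH1 IH2]].
  rewrite /cell /path_weight big_ord0 /= in_itv/= add0r subr0 divr1; split=> //; split=> // _ k.
  by rewrite leqn0 => /eqP ->.
have next : cell s n w -> selects (s n) (state n w).2 (state n.+1 w).1.
  move=> cw; have sn : (state n w).1 = s n by move/IH1: (cw) => /(_ n (leqnn n)).
  rewrite /state iterS /chain_step -/(state n w) /= sn.
  have [y hy] : exists y, selects (s n) (state n w).2 y.
    apply: selects_ex; rewrite (IH2 cw); have l0 := cell_len cw.
    rewrite ler_pdivlMr// ltr_pdivrMr// mul0r mul1r subr_ge0 ltrBlDl.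
    by move: cw; rewrite /cell /= in_itv.
  exact: (@xgetPex S (s n) [set z | selects (s n) (state n w).2 z] (ex_intro _ y hy)).
have main : (forall k, (k <= n.+1)%N -> (state k w).1 = s k) <-> cell s n.+1 w.
  split=> [h|cw'].
    have cw : cell s n w by apply/IH1 => k /leqW; exact: h.
    by apply/(cell_selects cw); rewrite -(IH2 cw) -(h n.+1 (leqnn _)); exact: next.
  have cw := cell_sub cw' => k; rewrite leq_eqVlt ltnS => /orP[/eqP ->|]; last first.
    by move: k; apply/IH1.
  by apply: selects_uniq (next cw) _; rewrite (IH2 cw); apply/cell_selects.
split=> // cw'; have cw := cell_sub cw'; move/main: (cw') => h.
have hn : (state n w).1 = s n by apply: h.
have := h n.+1 (leqnn _); rewrite {2}/state iterS /chain_step -/(state n w) /= hn => hs.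
have l0 := cell_len cw; have := cell_len cw'; rewrite lenS => l0'.
rewrite hs (IH2 cw) -/(path_weight s n).
have Pn0 : P (s n) (s n.+1) != 0%R by apply: contraTneq l0' => ->; rewrite mulr0 ltxx.
by field; rewrite Pn0 gt_eqF.
Qed.

(** Points outside the unit interval have no mass; staying at [x0] there makes the chain start
    at [x0] everywhere. *)
Definition interval_chain n (w : measurableTypeR R) : S :=
  if (0 <= w < 1)%R then (iter n chain_step (x0, w : R)).1 else x0.

(** Cells are intervals whose lengths are the path probabilities, so Lebesgue measure gives
    the finite-dimensional laws of the chain. *)
Lemma interval_chainP : markov_chain P x0 unit_interval_measure interval_chain.
Proof.
have X0 w : interval_chain 0 w = x0 by rewrite /interval_chain; case: ifP.
have cell_path s n w : s 0%N = x0 -> (0 <= w < 1)%R ->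
    (forall k, (k <= n)%N -> interval_chain k w = s k) <-> cell s n w.
  move=> s0 w01; have [<- _] := state_cell n s0 w01.
  by split=> h k kn; have := h k kn; rewrite /interval_chain w01.
have cell01 s n w : cell s n w -> (0 <= w < 1)%R.
  elim: n => [|n IH /cell_sub/IH//]; by rewrite /cell /path_weight big_ord0 /= in_itv/= add0r.
have law s n : unit_interval_measure [set w | forall k, (k <= n)%N -> interval_chain k w = s k] =
    if s 0%N == x0 then (path_weight s n)%:E else 0.
  case: eqP => s0; last first.
    rewrite (_ : [set w | _] = set0) ?measure0//; apply/seteqP; split=> // w /(_ 0%N isT).
    by rewrite X0 => /esym.
  rewrite /unit_interval_measure /= /mrestr (_ : _ `&` _ = cell s n).
    rewrite lebesgue_measure_itv /= lte_fin ltrDl; case: ltP => [_|l0].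
      by rewrite -EFinB addrAC subrr add0r.
    by congr (_%:E); apply/eqP; rewrite eq_le len_ge0.
  apply/seteqP; split=> w /=.
    by rewrite in_itv /= => -[h w01]; apply/cell_path.
  move=> cw; rewrite in_itv/= (cell01 _ _ _ cw); split=> //.
  by apply/cell_path => //; exact: cell01 cw.
split.
- move=> n y.
  have -> : interval_chain n @^-1` [set y] =
     (if y == x0 then ~` `[0%R, 1%R[%classic else set0) `|`
     \bigcup_(t in [set: seq S])
       (if (nth x0 t n == y) && (nth x0 t 0 == x0) then cell (nth x0 t) n else set0).
    apply/seteqP; split=> w /=.
      move=> Xw; have [w01|w01] := boolP (0 <= w < 1)%R; last first.
        left; move: Xw; rewrite /interval_chain (negbTE w01) => <-; rewrite eqxx /= in_itv /=.
        by apply/negP.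
      right; exists (mkseq (interval_chain ^~ w) n.+1) => //.
      rewrite !nth_mkseq// X0 Xw !eqxx; apply/cell_path => //; first by rewrite nth_mkseq.
      by move=> k kn; rewrite nth_mkseq.
    move=> [|[t _]].
      case: eqP => // -> /=; rewrite in_itv /= => /negP w01.
      by rewrite /interval_chain (negbTE w01).
    case: ifP => // /andP[/eqP tn /eqP t0] cw.
    by have /(cell_path _ _ _ t0 (cell01 _ _ _ cw)) h := cw; rewrite h.
  apply: measurableU; first by case: ifP => // _; apply: measurableC; exact: measurable_itv.
  apply: countable_bigcupT_measurable => [|t]; first exact: countableP.
  by case: ifP => // _; exact: measurable_itv.
- rewrite (_ : [set w | _] = setT) ?probability_setT//.
  by apply/seteqP; split=> w //= _; exact: X0.
- move=> n s; apply: etrans (law s n.+1) _.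
  transitivity ((if s 0%N == x0 then (path_weight s n)%:E else 0) * (P (s n) (s n.+1))%:E).
    by case: eqP => _; rewrite ?mul0e// lenS EFinM.
  by congr (_ * _); exact: esym (law s n).
Qed.

End ChainConstruction.

(** * Strong R-positivity and jumps of the spectral radius *)

Section Criterion.
Local Open Scope ereal_scope.
Context {R : realType} {S : countType}.
Implicit Types (A B : S -> S -> R) (x : S).

(** The analytic form of strong R-positivity: first returns at [x] have total weight [1] at
    the inverse [r] of the spectral radius, and still have finite weight at some larger [q]. *)
Definition passage_critical A x (r q : R) :=
  [/\ (0 < r)%R, (r < q)%R, passage_gf A x r x = 1 & passage_gf A x q x < +oo].

Lemma spectral_radius_real A x : nonnegative_matrix A -> irreducible A ->
  spectral_radius A < +oo -> exists2 rho : R, (0 < rho)%R & spectral_radius A = rho%:E.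
Proof.
move=> A0 irr soo; have s0 := spectral_radius_gt0 A0 irr x.
have sE : (fine (spectral_radius A))%:E = spectral_radius A.
  by apply: fineK; rewrite ge0_fin_numE// ltW.
by exists (fine (spectral_radius A)); rewrite ?sE// -lte_fin sE.
Qed.

(** The first-return generating function grows at least linearly in the radius, so it exceeds
    [1] to the right of [r]. *)
Lemma spectral_radius_critical A x (r : R) : nonnegative_matrix A -> irreducible A ->
  (0 < r)%R -> passage_gf A x r x = 1 -> spectral_radius A = (r^-1)%:E.
Proof.
move=> A0 irr r0 F1; have sr : spectral_radius A <= (r^-1)%:E.
  by apply: (spectral_radius_le_invr A0 irr r0 (x := x)); rewrite F1.
have [t t0 st] := spectral_radius_real x A0 irr (le_lt_trans sr (ltry _)).
apply/eqP; rewrite eq_le sr /= leNgt st lte_fin; apply/negP => tr.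
have F : passage_gf A x t^-1 x <= 1.
  by apply: passage_gf_le1_invr => //; rewrite ?invr_gt0// invrK st.
have c1 : (1 < r^-1 / t)%R by rewrite ltr_pdivlMr// mul1r.
have := passage_gf_scale A0 x x (ltW r0) (ltW c1).
rewrite F1 mule1 mulrAC mulVf ?gt_eqF// mul1r => /le_trans/(_ F).
by rewrite lee_fin leNgt c1.
Qed.

Lemma spectral_radius_homo A B x : nonnegative_matrix A -> nonnegative_matrix B ->
  irreducible A -> irreducible B -> (forall u v, B u v <= A u v)%R ->
  spectral_radius A < +oo -> spectral_radius B <= spectral_radius A.
Proof.
move=> A0 B0 Airr Birr BA /(spectral_radius_real x A0 Airr)[t t0 st].
have ti0 : (0 < t^-1)%R by rewrite invr_gt0.
rewrite st -[t]invrK; apply: (spectral_radius_le_invr B0 Birr (x := x) ti0).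
apply: le_trans (passage_gf_le B0 x x BA (ltW ti0)) _.
by apply: passage_gf_le1_invr; rewrite ?invr_gt0 ?invrK ?st.
Qed.

(** By rigidity the first-return generating function of [B] is strictly below [1] at [r]; being
    finite at [q] it stays at most [1] up to some [s > r], and [s^-1] bounds the radius. *)
Lemma spectral_radius_lt A B x (r q : R) : nonnegative_matrix A -> nonnegative_matrix B ->
  irreducible B -> (forall u v, B u v <= A u v)%R -> (forall u v, 0 < B u v <-> 0 < A u v)%R ->
  B <> A -> passage_critical A x r q -> spectral_radius B < spectral_radius A.
Proof.
move=> A0 B0 Birr BA supp neq [r0 rq FA FAq].
have Airr : irreducible A by apply: irreducible_support Birr => // u v /supp.
have q0 := lt_trans r0 rq.
have FB : passage_gf B x r x < 1.
  rewrite lt_neqAle -{2}FA passage_gf_le ?andbT//; last exact: ltW.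
  by apply/eqP => FB; apply: neq; apply: (passage_gf_rigid A0 B0 r0 Birr BA supp FA FB).
have FBq := le_lt_trans (passage_gf_le B0 x x BA (ltW q0)) FAq.
have [s rs Fs] := passage_gf_beyond B0 (ltW r0) rq FB FBq.
have s0 := lt_trans r0 rs.
rewrite (spectral_radius_critical A0 Airr r0 FA).
apply: le_lt_trans (spectral_radius_le_invr B0 Birr s0 Fs) _.
by rewrite lte_fin ltf_pV2.
Qed.

(** At the inverse radius of [B], which lies to the right of that of [A], the first returns of
    [B] to [x] have weight at most [1], and those of [A] at most [c] times as much. A value
    below [1] at the inverse radius of [A] would then make that radius smaller. *)
Lemma passage_critical_row A B x (c : R) : nonnegative_matrix A -> nonnegative_matrix B ->
  irreducible A -> irreducible B -> spectral_radius A < +oo -> (0 <= c)%R ->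
  (forall y z, y <> x -> A y z = B y z) -> (forall z, A x z <= c * B x z)%R ->
  spectral_radius B < spectral_radius A -> exists r q, passage_critical A x r q.
Proof.
move=> A0 B0 Airr Birr soo c0 rows row_x BA.
have [a a0 sA] := spectral_radius_real x A0 Airr soo.
have [b b0 sB] := spectral_radius_real x B0 Birr (lt_trans BA soo).
have ba : (b < a)%R by rewrite -lte_fin -sA -sB.
have ai0 : (0 < a^-1)%R by rewrite invr_gt0.
have bi0 : (0 < b^-1)%R by rewrite invr_gt0.
have Fq : passage_gf A x b^-1 x < +oo.
  apply: le_lt_trans (passage_gf_row_change B0 c0 (ltW bi0) rows row_x) _.
  apply: le_lt_trans (ltry c); rewrite -[leRHS]mule1; apply: lee_wpmul2l; rewrite ?lee_fin//.
  by apply: passage_gf_le1_invr; rewrite ?invrK ?sB.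
exists a^-1%R, b^-1%R; split=> //; first by rewrite ltf_pV2.
apply/eqP; rewrite eq_le passage_gf_le1_invr ?invrK ?sA//= leNgt; apply/negP => F1.
have [|s as_ Fs] := passage_gf_beyond A0 (ltW ai0) _ F1 Fq; first by rewrite ltf_pV2.
have s0 := lt_trans ai0 as_.
have := spectral_radius_le_invr A0 Airr s0 Fs; rewrite sA lee_fin leNgt.
by rewrite -{1}[a]invrK ltf_pV2 ?posrE// as_.
Qed.

(** Reset one entry of [A] to its value in [B]. If this lowers the spectral radius,
    the row criterion applies. If not, the smaller matrix is critical by induction, and rigidity
    at the common radius shows that the entry already had its value in [B]. *)
Lemma passage_critical_of_jump B (E : seq (S * S)) A : nonnegative_matrix A ->
  nonnegative_matrix B -> irreducible B -> spectral_radius A < +oo ->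
  (forall u v, B u v <= A u v)%R -> (forall u v, 0 < B u v <-> 0 < A u v)%R ->
  (forall u v, (u, v) \notin E -> A u v = B u v) ->
  spectral_radius B < spectral_radius A -> exists x r q, passage_critical A x r q.
Proof.
move=> + B0 Birr; elim: E A => [|[u v] E IH] A A0 soo BA supp off jump.
  suff AB : A = B by move: jump; rewrite AB ltxx.
  by apply/funext => y; apply/funext => z; exact: off.
pose A' y z := if (y, z) == (u, v) then B u v else A y z.
have A'A y z : (A' y z <= A y z)%R.
  by rewrite /A'; case: eqP => // -[-> ->].
have BA' y z : (B y z <= A' y z)%R.
  by rewrite /A'; case: eqP => // -[-> ->].
have A'0 : nonnegative_matrix A' by move=> y z; apply: le_trans (BA' y z).
have suppA' y z : (0 < B y z <-> 0 < A' y z)%R.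
  rewrite /A'; case: eqP => [[-> ->]//|_]; exact: supp.
have suppA y z : (0 < A' y z <-> 0 < A y z)%R.
  by split=> [/suppA'/supp//|/supp/suppA'].
have A'irr : irreducible A' by apply: irreducible_support Birr => // y z /suppA'.
have Airr : irreducible A by apply: irreducible_support Birr => // y z /supp.
have off' y z : (y, z) \notin E -> A' y z = B y z.
  move=> yzE; rewrite /A'; case: eqP => [[-> ->]//|/eqP ne].
  by apply: off; rewrite inE negb_or ne.
have A'soo := le_lt_trans (spectral_radius_homo u A0 A'0 Airr A'irr A'A soo) soo.
have [lt|ge] := ltP (spectral_radius A') (spectral_radius A).
  (* The summand [1] handles the entries of row [u] that did not change. *)
  have c0 : (0 <= 1 + A u v / B u v)%R by rewrite addr_ge0// divr_ge0.
  exists u; apply: (passage_critical_row A0 A'0 Airr A'irr soo c0 _ _ lt).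
    by move=> y z yu; rewrite /A'; case: eqP => // -[].
  move=> z; rewrite /A'; case: eqP => [[->]|_].
    have [Buv|Buv] := ltP 0%R (B u v).
      by rewrite mulrDl mul1r mulfVK ?gt_eqF// lerDr.
    have -> : B u v = 0%R by apply/eqP; rewrite eq_le Buv B0.
    by rewrite mulr0 leNgt; apply/negP => /supp; rewrite ltNge Buv.
  by rewrite ler_peMl// lerDl divr_ge0.
have [|x [r [q crit]]] := IH A' A'0 A'soo BA' suppA' off'; first exact: lt_le_trans ge.
have [r0 rq F' _] := crit.
have F : passage_gf A x r x = 1.
  apply/eqP; rewrite eq_le -{2}F' passage_gf_le ?andbT//; last exact: ltW.
  apply: passage_gf_le1_invr => //.
  by rewrite -(spectral_radius_critical A'0 A'irr r0 F').
exists x, r, q; rewrite -(passage_gf_rigid A0 A'0 r0 A'irr A'A suppA F F').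
exact: crit.
Qed.

Lemma critical_of_strongly_R_positive A : nonnegative_matrix A -> strongly_R_positive A ->
  exists x r q, passage_critical A x r q.
Proof.
move=> A0 [_ [h [c [h0 c0 _ rec [kernel _ [x [e e0 [d [T [Pr [X [chain Eoo]]]]]]]]]]]].
have P0 : nonnegative_matrix (h_transform A h c) by exact: h_transform_ge0.
have F1 : passage_gf (h_transform A h c) x 1 x = 1.
  by have [d' [T' [Pr' [X' [/(prob_return P0) <- ]]]]] := rec x.
move: Eoo; rewrite (expectation_return P0 chain e F1) => Foo.
exists x, c^-1%R, (expR e / c)%R; split.
- by rewrite invr_gt0.
- by rewrite ltr_pMl ?invr_gt0// expR_gt1.
- by rewrite -[c^-1%R]mul1r -(passage_gf_h_transform A0 h0 c0).
- by rewrite -(passage_gf_h_transform A0 h0 c0).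
Qed.

Lemma strongly_R_positive_of_critical A x (r q : R) : nonnegative_matrix A -> irreducible A ->
  passage_critical A x r q -> strongly_R_positive A.
Proof.
move=> A0 irr [r0 rq F1 Fq]; have sr := spectral_radius_critical A0 irr r0 F1.
have pgf0 y := passage_gf_gt0 A0 irr y r0 F1.
have pgfoo y := passage_gf_lt_pinfty A0 irr y r0 F1.
have ri0 : (0 < r^-1)%R by rewrite invr_gt0.
split.
  split=> //; first by rewrite sr ltry.
  exists x; rewrite sr /=; have := green_gf_pinfty A0 (ltW r0) F1.
  rewrite /green_gf -nneseries_esumT => [|n]; last first.
    by apply: mule_ge0; rewrite ?lee_fin ?exprn_ge0 ?matrix_pow_ge0// ltW.
  rewrite nneseries_recl//; last first.
    by move=> n _; apply: mule_ge0; rewrite ?lee_fin ?exprn_ge0 ?matrix_pow_ge0// ltW.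
  rewrite /= eqxx mule1 expr0 => div.
  have add1 (y : \bar R) : 1 + y = +oo -> y = +oo by case: y.
  rewrite -(add1 _ div); apply: congr_lim; apply/funext => n; apply: eq_bigr => k _.
  by rewrite exprVn invrK.
pose h y := fine (passage_gf A x r y).
have hE y : (h y)%:E = passage_gf A x r y by rewrite fineK// ge0_fin_numE// ltW.
have h0 y : (0 < h y)%R by rewrite -lte_fin hE.
have P0 : nonnegative_matrix (h_transform A h r^-1) by exact: h_transform_ge0.
have kernel : is_probability_kernel (h_transform A h r^-1).
  split=> // y; transitivity ((h y)^-1%:E *
      \esum_(z in [set: S]) ((r * A y z)%:E * passage_gf A x r z)).
    rewrite -esumZl; last 2 first.
    - by rewrite lee_fin invr_ge0 ltW.
    - by move=> z; apply: mule_ge0; [rewrite lee_fin mulr_ge0// ltW|exact: ltW].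
    apply: eq_esum => z _; rewrite -hE -!EFinM /h_transform invrK; congr (_%:E).
    by rewrite !mulrA [(_ * r)%R]mulrC.
  by rewrite passage_gf_harmonic ?(ltW r0)// -hE -EFinM mulVf ?gt_eqF.
have ret w : passage_gf (h_transform A h r^-1) w 1 w = 1.
  rewrite passage_gf_h_transform// invrK mul1r.
  by apply: passage_gf_eq1 F1 => //; rewrite sr.
exists h, r^-1%R; split=> //.
  move=> w; exists _, _, unit_interval_measure, (interval_chain (h_transform A h r^-1) w).
  split; first exact: interval_chainP.
  by rewrite (prob_return P0 (interval_chainP w kernel)).
split=> //; first exact: h_transform_irreducible.
(* With this exponent each step multiplies the weight by [q / r], which moves [r] to [q]. *)
exists x, (ln (q / r)).
  by rewrite ln_gt0// ltr_pdivlMr// mul1r.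
exists _, _, unit_interval_measure, (interval_chain (h_transform A h r^-1) x).
split; first exact: interval_chainP.
rewrite (expectation_return P0 (interval_chainP x kernel))//.
rewrite lnK ?posrE ?divr_gt0//; last exact: lt_trans rq.
by rewrite passage_gf_h_transform// invrK mulfVK ?gt_eqF.
Qed.

End Criterion.

Theorem theorem4 (R : realType) (S : countType) (A B : S -> S -> R)
    (A_ge0 : nonnegative_matrix A) (A_irr : irreducible A)
    (rhoA_fin : (spectral_radius A < +oo)%E)
    (B_ge0 : nonnegative_matrix B) (leBA : forall x y, B x y <= A x y)
    (suppBA : forall x y, 0 < B x y <-> 0 < A x y) (neqBA : B <> A) :
  (strongly_R_positive A -> (spectral_radius B < spectral_radius A)%E) /\
  ((spectral_radius B < spectral_radius A)%E ->
   finite_set [set p : S * S | A p.1 p.2 <> B p.1 p.2] ->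
   strongly_R_positive A).
Proof.
have B_irr : irreducible B by apply: irreducible_support A_irr => // u v /suppBA.
split=> [/(critical_of_strongly_R_positive A_ge0)[x [r [q crit]]]|jump /finite_seqP[E EE]].
  exact: spectral_radius_lt crit.
have off u v : (u, v) \notin E -> A u v = B u v.
  move=> uvE; apply: contrapT => ne; move/negP: uvE; apply.
  suff : [set` E] (u, v) by [].
  by rewrite -EE.
have [x [r [q crit]]] :=
  passage_critical_of_jump A_ge0 B_ge0 B_irr rhoA_fin leBA suppBA off jump.
exact: strongly_R_positive_of_critical crit.
Qed.
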